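(* Assume that $g$ satisfies (H1), (H2) and (H3) of the context, and let \[ c^*:=\inf_{\lambda>0}\frac{D(e^{\lambda}+e^{-\lambda}-2)+g(0,0)}{\lambda}. \] Consider the equation \[ \frac{du_n(t)}{dt}=D\left(u_{n+1}(t)-2u_n(t)+u_{n-1}(t)\right)+u_n(t)\,g(u_n(t),u_n(t-\tau)),\qquad n\in\mathbb{Z},\ t>0, \tag{E} \] and the condition \[ \lim_{\xi\to-\infty}\phi(\xi)=0,\qquad 0<\liminf_{\xi\to\infty}\phi(\xi)\le\limsup_{\xi\to\infty}\phi(\xi)\le1. \tag{B} \] If $c\ge c^*$, then (E) has a positive traveling wave solution with wave speed $c$ whose profile $\phi$ satisfies (B). If $0<c<c^*$, then (E) has no positive traveling wave solution with wave speed $c$ whose profile $\phi$ satisfies (B). Moreover, if in addition (H4) holds and $c\ge c^*$, then the positive traveling wave solution $\phi$ also satisfies \[ \lim_{\xi\to-\infty}\phi(\xi)=0,\qquad \lim_{\xi\to\infty}\phi(\xi)=E. \]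
   Context: Constants: $D>0$ and a time delay $\tau\ge 0$ are fixed. The function $g:\mathbb{R}^2\to\mathbb{R}$ is subject to the assumptions: (H1) $g(1,0)=0$ and $g(u,0)>0$ for $u\in(0,1)$. (H2) $g(u,v)$ is Lipschitz continuous and strictly monotone decreasing (in $u$ and in $v$) for $u,v\in[0,1]$, and $g(u,0)\to-\infty$ as $u\to\infty$. (H3) $g(0,1)>0$, and there exists $E\in(0,1)$ such that $g(E,E)=0$. (H4) If $1>\overline{u}\ge\underline{u}>0$ are such that $g(\underline{u},\overline{u})\le0$ and $g(\overline{u},\underline{u})\ge0$, then $\underline{u}=\overline{u}=E$. Traveling wave solution: a solution of (E) of the form $u_n(t)=\phi(n+ct)$, where $c>0$ is the wave speed and $\phi\in C^1(\mathbb{R},\mathbb{R})$ is the wave profile; here $\phi\in C^1(\mathbb{R},\mathbb{R})$ means that $\phi$ and $\phi'$ are both uniformly continuous and bounded on $\mathbb{R}$. Equivalently, $c\phi'(\xi)=D(\phi(\xi+1)+\phi(\xi-1)-2\phi(\xi))+\phi(\xi)g(\phi(\xi),\phi(\xi-c\tau))$ for all $\xi\in\mathbb{R}$. Positive means $\phi(\xi)>0$ for all $\xi\in\mathbb{R}$. *)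

(* Defs.v *)
From mathcomp Require Import all_boot all_order all_algebra.
From mathcomp Require Import all_classical all_reals all_analysis.

Set Implicit Arguments.
Unset Strict Implicit.
Unset Printing Implicit Defensive.

Import Order.TTheory GRing.Theory Num.Theory.
Import numFieldNormedType.Exports.

Local Open Scope classical_set_scope.
Local Open Scope ring_scope.

Definition H1 (R : realType) (g : R -> R -> R) : Prop :=
  g 1 0 = 0 /\ forall u : R, 0 < u < 1 -> 0 < g u 0.

Definition H2 (R : realType) (g : R -> R -> R) : Prop :=
  [/\ [lipschitz (g p.1 p.2 : R) | p in [set p : R * R | 0 <= p.1 <= 1 /\ 0 <= p.2 <= 1]],
      forall u1 u2 v : R, 0 <= u1 -> u1 < u2 -> u2 <= 1 -> 0 <= v <= 1 ->
        g u2 v < g u1 v,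
      forall u v1 v2 : R, 0 <= u <= 1 -> 0 <= v1 -> v1 < v2 -> v2 <= 1 ->
        g u v2 < g u v1
    & g u 0 @[u --> +oo] --> -oo].

(* E is an argument because (H4) and the limit at +oo refer to it; (H2) makes
   it unique. *)
Definition H3 (R : realType) (g : R -> R -> R) (E : R) : Prop :=
  [/\ 0 < g 0 1, 0 < E < 1 & g E E = 0].

Definition H4 (R : realType) (g : R -> R -> R) (E : R) : Prop :=
  forall ul uh : R, 0 < ul -> ul <= uh -> uh < 1 ->
    g ul uh <= 0 -> 0 <= g uh ul -> ul = E /\ uh = E.

Definition cstar (R : realType) (D : R) (g : R -> R -> R) : R :=
  inf [set (D * (expR l + expR (- l) - 2) + g 0 0) / l | l in [set l : R | 0 < l]].

Definition lattice_solution (R : realType) (D tau : R) (g : R -> R -> R)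
    (u : int -> R -> R) : Prop :=
  forall (n : int) (t : R), 0 < t ->
    is_derive t 1 (u n)
      (D * (u (n + 1) t - 2 * u n t + u (n - 1) t)
       + u n t * g (u n t) (u n (t - tau))).

(* C^1(R, R) in the sense of bounded uniformly continuous functions whose
   derivative is also bounded and uniformly continuous. *)
Definition C1_buc (R : realType) (phi : R -> R) : Prop :=
  [/\ forall x : R, derivable phi x 1,
      unif_continuous phi, bounded_fun phi,
      unif_continuous (derive1 phi) & bounded_fun (derive1 phi)].

Definition traveling_wave (R : realType) (D tau : R) (g : R -> R -> R)
    (c : R) (phi : R -> R) : Prop :=
  [/\ 0 < c, C1_buc phi
    & lattice_solution D tau g (fun n t => phi (n%:~R + c * t))].

Definition positive_traveling_wave (R : realType) (D tau : R)
    (g : R -> R -> R) (c : R) (phi : R -> R) : Prop :=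
  traveling_wave D tau g c phi /\ forall xi : R, 0 < phi xi.

Definition liminf_pinfty (R : realType) (phi : R -> R) : \bar R :=
  limf_einf (EFin \o phi) (pinfty_nbhs R).

Definition limsup_pinfty (R : realType) (phi : R -> R) : \bar R :=
  limf_esup (EFin \o phi) (pinfty_nbhs R).

Definition condB (R : realType) (phi : R -> R) : Prop :=
  [/\ phi xi @[xi --> -oo] --> (0 : R),
      (0 < liminf_pinfty phi)%E,
      (liminf_pinfty phi <= limsup_pinfty phi)%E
    & (limsup_pinfty phi <= 1)%E].

Definition connects_0_E (R : realType) (E : R) (phi : R -> R) : Prop :=
  phi xi @[xi --> -oo] --> (0 : R) /\ phi xi @[xi --> +oo] --> E.

(* Main.v *)
Require Import Defs.
From mathcomp Require Import all_boot all_order all_fingroup all_algebra.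
From mathcomp Require Import all_classical all_reals all_analysis.
From mathcomp Require Import zify ring lra.

Set Implicit Arguments.
Unset Strict Implicit.
Unset Printing Implicit Defensive.

Import Order.TTheory GRing.Theory Num.Theory.
Import numFieldNormedType.Exports.

(** Why the theorem holds.

    The profile of a wave of speed c solves
      c phi' = D (phi (x + 1) + phi (x - 1) - 2 phi) + phi g(phi, phi (x - c tau)).
    The ansatz e^{mu x} in the linearisation at 0 gives the dispersion relation
      D (e^mu + e^-mu - 2) + g(0,0) - c mu,
    and c* is the infimum of the speeds at which it is negative for some
    mu > 0.

    Speeds below c*.  Now the dispersion relation is positive at every mu > 0,
    in particular at its minimiser a.  Therefore e^{a x} max(0, r^2 - x^2)
    with r large is a compactly supported strict subsolution of the linearised
    equation.  It is put so far to the left that phi is nearly 0 on its support,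
    and multiplied by the largest factor that keeps it below phi; at a point of
    contact the two equations contradict each other ([no_subcritical_profile]).
    Only the behaviour of phi near -oo enters.

    Speeds above c*.  The equation looks forward (phi (x + 1)) and decreases in
    its delayed argument, so neither an initial value problem nor monotone
    iteration applies, and a topological fixed point theorem is needed.
    Approximate Brouwer fixed points come from a parity count of fully labelled
    simplices in a triangulated torus ([even_full], [kuhn_cube],
    [brouwer_approx]), and pointwise compactness turns them into fixed points of
    maps on sequences indexed by the integers ([lattice_fixed_point]).  This
    solves the equation in which the derivative is replaced by a backward
    difference, between the barriers max(0, e^{lam x} - q e^{eta x}) and
    min(1, e^{lam x}), where lam is a root of the dispersion relation
    ([discrete_wave]).  Letting the mesh tend to 0 gives the wave
    ([supercritical_profile]).

    All speeds c >= c*.  Take waves with speeds decreasing to c, translate them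
    so that they equal d at 0 and are at most d on the left of 0, and pass to a
    pointwise cluster point ([profile_exists]).  That the limit behaves well at
    both ends is a consequence of [persistence]: as g(0,1) > 0, a solution that
    is at least e somewhere is at least delta from a bounded distance to the right
    of that point on, where delta depends on neither e nor the solution.  Hence
    the limit inferior at +oo is positive; and if d < delta, then a solution that
    is d at 0 must tend to 0 at -oo, because a value e far to the left would force
    the value at 0 up to delta.

    Convergence to E.  Let ul and uh be the limits inferior and superior of phi
    at +oo.  Near a level uh with g(uh,ul) < 0 the profile would have negative
    slope, hence drop below that level for good; so g(uh,ul) >= 0, and likewise
    g(ul,uh) <= 0.  By (H4) both limits are E ([profile_cvg]). *)

Local Open Scope ring_scope.

(** * Fully labelled simplices *)

Section Combinatorics.
(* Sets are finite sets in this section. *)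
Import mathcomp.boot.fintype mathcomp.boot.finset.

(** The elements ranked below their image are half of A: the involution
    exchanges them with the others. *)
Lemma odd_card_involution (T : finType) (A : {set T}) (f : T -> T) :
  {in A, forall x, f x \in A} -> {in A, involutive f} ->
  {in A, forall x, f x != x} -> ~~ odd #|A|.
Proof.
move=> fA fK fx.
pose lo := [set x in A | enum_rank x < enum_rank (f x)]%N.
have -> : A = lo :|: f @: lo.
  apply/setP => x; rewrite !inE; apply/idP/idP.
    move=> xA; rewrite xA /=; case: (ltngtP (enum_rank x) (enum_rank (f x))) => //= h.
      apply/imsetP; exists (f x); last by rewrite fK.
      by rewrite inE fA //= fK.
    by have := fx _ xA; rewrite -(inj_eq enum_rank_inj) -val_eqE /= h eqxx.
  case/orP => [/andP[]//|/imsetP[y]]; rewrite inE => /andP[yA _] ->.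
  exact: fA.
have dis : lo :&: f @: lo = set0.
  apply/setP => x; rewrite !inE; apply/negP => /andP[/andP[xA h1] /imsetP[y]].
  rewrite inE => /andP[yA h2] xE; move: h1; rewrite xE fK //.
  by move/(ltn_trans h2); rewrite ltnn.
rewrite cardsU dis cards0 subn0 card_in_imset; first by rewrite addnn odd_double.
move=> x y; rewrite !inE => /andP[xA _] /andP[yA _] e.
by rewrite -(fK x xA) e fK.
Qed.

(** A door is a facet that carries every label but t0, given by the vertex j
    opposite to it.  A simplex with all labels has one door, opposite to the vertex
    labelled t0.  Any other simplex with a door repeats exactly one label, and
    its doors are opposite to the two vertices that share this label. *)
Lemma odd_card_doors (T : finType) (t0 : T) (f : T -> T) :
  odd #|[set j | [forall a, (a != t0) ==> [exists i, (i != j) && (f i == a)]]]|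
  = injectiveb f.
Proof.
set D := [set j | _].
have DP j : reflect (forall a, a != t0 -> exists2 i, i != j & f i = a) (j \in D).
  rewrite inE; apply: (iffP forallP) => h a.
    move=> a0; have /implyP/(_ a0)/existsP[i /andP[ij /eqP e]] := h a.
    by exists i.
  apply/implyP => /h[i ij e]; apply/existsP; exists i; by rewrite ij e eqxx.
case: (boolP (injectiveb f)) => [/injectiveP finj|fninj].
  suff -> : D = [set invF finj t0] by rewrite cards1.
  apply/setP => j; rewrite in_set1; apply/DP/eqP.
    move=> h; apply: (finj _ _); rewrite f_invF; apply/eqP/negPn/negP => /h[i ij e].
    by move/eqP: ij => []; exact: (finj _ _ e).
  move=> -> a a0; exists (invF finj a); last by rewrite f_invF.
  by rewrite (can_eq (f_invF finj)).
case: (set_0Vmem D) => [->|[j /DP jD]]; first by rewrite cards0.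
(* By counting, f is a bijection from the complement of j to that of t0. *)
have imE : f @: [set~ j] = [set~ t0].
  apply/esym/eqP; rewrite eqEcard; apply/andP; split.
    apply/subsetP => a; rewrite !inE => /jD[i ij <-].
    by apply: imset_f; rewrite !inE.
  by rewrite (leq_trans (leq_imset_card _ _))// !cardsC1.
have inj' : {in [set~ j] &, injective f}.
  by apply/imset_injP; rewrite imE !cardsC1.
have fj0 : f j != t0.
  apply: contra fninj => /eqP fj0; apply/injectiveP => x y.
  have [->|xj] := eqVneq x j; have [->|yj] := eqVneq y j => // e.
  - have : f y \in f @: [set~ j] by apply: imset_f; rewrite !inE.
    by rewrite -e imE !inE fj0 eqxx.
  - have : f x \in f @: [set~ j] by apply: imset_f; rewrite !inE.
    by rewrite e imE !inE fj0 eqxx.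
  - by apply: inj' => //; rewrite !inE.
have [j' j'j fj'] := jD _ fj0.
suff -> : D = [set j; j'] by rewrite cards2 eq_sym j'j.
apply/setP => k; rewrite in_set2; apply/idP/idP.
  move=> /DP kD.
  apply/negPn/negP; rewrite negb_or => /andP[kj kj'].
  have : f k != t0.
    have : f k \in f @: [set~ j] by apply: imset_f; rewrite !inE.
    by rewrite imE !inE.
  move=> /kD[i ik e]; have [ij|ij] := eqVneq i j.
    move: e; rewrite ij -fj' => /inj'; rewrite !inE => /(_ j'j kj) e.
    by rewrite e eqxx in kj'.
  by move/inj': e; rewrite !inE => /(_ ij kj) e; rewrite e eqxx in ik.
case/orP => /eqP->; apply/DP => // a /jD[i ij e].
have [ij'|ij'] := eqVneq i j'; last by exists i.
by exists j; rewrite 1?eq_sym// -fj' -ij'.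
Qed.

Section Torus.
Variables (n m : nat).
Notation vertex := {ffun 'I_n.+1 -> 'I_m.+2}.
Notation simplex := (vertex * 'S_n.+1)%type.

(** The simplices of the Freudenthal triangulation of the torus (Z/(m+2))^(n+1):
    (b, p) is the chain that starts at b and increases the coordinate x by one
    in its step number p x. *)
Definition vtx (s : simplex) (j : nat) : vertex :=
  [ffun x => s.1 x + ((s.2 x < j)%N)%:R].

Definition rot : 'S_n.+1 := perm (@ordS_inj n.+1).

Lemma rotE x : rot x = (x.+1 %% n.+1)%N :> nat.
Proof. by rewrite permE. Qed.

Lemma rotVE x : (rot^-1)%g x = ((x + n) %% n.+1)%N :> nat.
Proof.
suff -> : (rot^-1)%g x = ord_pred x by rewrite /= addnS.
by apply: (@perm_inj _ rot); rewrite permKV permE ord_predK.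
Qed.

(** The simplex on the other side of the facet opposite to vertex j, together
    with the position of its new vertex: two consecutive steps are exchanged if j
    is an inner vertex of the chain; otherwise the chain loses an end vertex and
    grows by one step at its other end. *)
Definition pivot (x : simplex * 'I_n.+2) : simplex * 'I_n.+2 :=
  let: ((b, p), j) := x in
  if (j : nat) == 0 then
    (([ffun x => b x + ((p x : nat) == 0)%:R], (p * rot^-1)%g), ord_max)
  else if j == ord_max then
    (([ffun x => b x - ((p x : nat) == n)%:R], (p * rot)%g), ord0)
  else ((b, (p * tperm (inord j.-1) (inord j))%g), j).

Lemma pivotK : involutive pivot.
Proof.
move=> [[b p] j]; rewrite /pivot.
have [j0|j0] /= := eqVneq (j : nat) 0%N.
  rewrite eqxx;  congr (_, _, _).
  - apply/ffunP => x; rewrite !ffunE permM rotVE.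
    suff -> : ((p x + n) %% n.+1 == n)%N = ((p x : nat) == 0) by rewrite addrK.
    have := ltn_ord (p x); case: (p x : nat) => [|k] h.
      by rewrite add0n modn_small ?eqxx.
    by rewrite addSnnS modnDr modn_small; lia.
  - by rewrite mulgKV.
  - exact/val_inj.
have [jm|jm] /= := eqVneq j ord_max.
  congr (_, _, _).
  - apply/ffunP => x; rewrite !ffunE permM rotE.
    suff -> : ((p x).+1 %% n.+1 == 0)%N = ((p x : nat) == n) by rewrite subrK.
    have := ltn_ord (p x) => h; case: (eqVneq (p x : nat) n) => [->|hn].
      by rewrite modnn.
    by rewrite modn_small; lia.
  - by rewrite mulgK.
  - by rewrite jm.
rewrite (negbTE j0) (negbTE jm) -mulgA tperm2 mulg1.
by [].
Qed.

Lemma pivot_neq x : pivot x != x.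
Proof.
case: x => [[b p] j]; rewrite /pivot.
have [j0|j0] /= := eqVneq (j : nat) 0%N.
  by rewrite -pair_eqE /= -[_ == j]val_eqE /= j0 andbF.
have [->|jm] /= := eqVneq j ord_max; first by rewrite -pair_eqE /= andbF.
rewrite -pair_eqE /= eqxx andbT -pair_eqE /= eqxx /=.
apply/eqP => /permP; move: (ltn_ord j) => jlt.
have jn : (j < n.+1)%N.
  by move: jm; rewrite -val_eqE /=; lia.
move/(_ (p^-1%g (inord j))); rewrite permM !permKV tpermR => /(congr1 (@nat_of_ord _)).
by rewrite !inordK; lia.
Qed.

Lemma pivot_vtx (x : simplex * 'I_n.+2) (i : 'I_n.+2) : i != x.2 ->
  exists2 i' : 'I_n.+2, i' != (pivot x).2 & vtx (pivot x).1 i' = vtx x.1 i.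
Proof.
case: x => [[b p] j] /= ij; rewrite /pivot.
have [j0|j0] /= := eqVneq (j : nat) 0%N.
  have i0 : (0 < i)%N by move: ij; rewrite -val_eqE /= j0; lia.
  have hi := ltn_ord i.
  have h1 : (i.-1 < n.+2)%N by lia.
  exists (Ordinal h1); first by rewrite -val_eqE /=; lia.
  apply/ffunP => x; rewrite !ffunE /= permM rotVE -addrA; congr (_ + _).
  have := ltn_ord (p x); case: (p x : nat) => [|k] h.
    rewrite add0n modn_small //= i0.
    by rewrite ltnNge (_ : (i.-1 <= n)%N) ?addr0 //; lia.
  rewrite addSnnS modnDr modn_small; last by lia.
  by rewrite add0r; congr (nat_of_bool _)%:R; lia.
have [jm|jm] /= := eqVneq j ord_max.
  have hi : (i < n.+1)%N.
    by move: ij (ltn_ord i); rewrite jm -val_eqE /=; lia.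
  have h1 : (i.+1 < n.+2)%N by lia.
  exists (Ordinal h1); first by rewrite -val_eqE /=; lia.
  apply/ffunP => x; rewrite !ffunE /= permM rotE -addrA; congr (_ + _).
  have := ltn_ord (p x) => h; case: (eqVneq (p x : nat) n) => [->|hn].
    rewrite modnn ltnS /=.
    have -> : (n < i)%N = false by lia.
    by rewrite addNr.
  by rewrite oppr0 add0r modn_small ?ltnS //; lia.
exists i => //; apply/ffunP => x; rewrite !ffunE /= permM.
have jlt : (j < n.+1)%N.
  by move: jm (ltn_ord j); rewrite -val_eqE /=; lia.
congr (_ + (nat_of_bool _)%:R); move: ij; rewrite -val_eqE /= => ij.
by case: tpermP => [->|->|//]; rewrite !inordK; lia.
Qed.

Variable lab : vertex -> 'I_n.+2.

Definition full (s : simplex) := injectiveb (fun i : 'I_n.+2 => lab (vtx s i)).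

Definition door (x : simplex * 'I_n.+2) :=
  [forall a, (a != ord_max) ==>
     [exists i : 'I_n.+2, (i != x.2) && (lab (vtx x.1 i) == a)]].

Lemma door_pivot x : door x -> door (pivot x).
Proof.
move=> /forallP h; apply/forallP => a; apply/implyP => am.
have /implyP/(_ am)/existsP[i /andP[ix /eqP e]] := h a.
have [i' i'x e'] := pivot_vtx ix.
by apply/existsP; exists i'; rewrite i'x e' e eqxx.
Qed.

(** The doors of all simplices are paired by [pivot], and a simplex has an odd
    number of doors exactly when it is fully labelled. *)
Lemma even_full : ~~ odd #|[set s | full s]|.
Proof.
have : ~~ odd #|[set x | door x]|.
  apply: (@odd_card_involution _ _ pivot) => [x|x _|x _].
  - by rewrite !inE; exact: door_pivot.
  - exact: pivotK.
  - exact: pivot_neq.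
congr (~~ _).
rewrite -sum1dep_card (eq_bigl (fun x => xpredT x.1 && door (x.1, x.2))); last by case.
rewrite -(pair_big_dep xpredT (fun s j => door (s, j)) (fun _ _ => 1%N)) /=.
rewrite -sum1dep_card.
rewrite [X in _ = odd X]big_mkcond /=.
apply: (big_ind2 (fun x y => odd x = odd y)) => // [x1 x2 y1 y2 e1 e2|s _].
  by rewrite !oddD e1 e2.
rewrite sum1dep_card (odd_card_doors ord_max (fun i => lab (vtx s i))) -/(full s).
by case: full.
Qed.
End Torus.

(** By strong induction on i: if f i < i, then f i is a fixed point by induction
    and f is not injective; if f i > i, then the value i is taken to the right of
    i and f is not monotone. *)
Lemma homo_inj_ord_id N (f : 'I_N -> 'I_N) :
  injective f -> {homo f : i j / (i <= j)%N} -> f =1 id.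
Proof.
move=> finj fh i; apply/val_inj => /=.
have [k] := ubnP (i : nat); elim: k i => // k IH i ik.
case: (ltngtP (f i) i) => // fi.
  by have := IH (f i) (leq_trans fi ik) => /val_inj/finj e; rewrite e ltnn in fi.
have ij : f (invF finj i) = i by exact: f_invF.
have [ji|ji] := ltnP (invF finj i) i.
  by have := IH _ (leq_trans ji ik); rewrite ij => e; rewrite e ltnn in ji.
by have := fh _ _ ji; rewrite ij leqNgt fi.
Qed.

Section FirstTrue.
Variables (n : nat) (T : Type) (P : T -> 'I_n.+1 -> bool).

(** The label of v is the first i with P v i; the last label means that there is
    none. *)
Definition first_true (v : T) : 'I_n.+2 := inord (find (P v) (enum 'I_n.+1)).

Let first_trueE v : first_true v = find (P v) (enum 'I_n.+1) :> nat.
Proof.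
rewrite inordK// ltnS; have := find_size (P v) (enum 'I_n.+1).
by rewrite size_enum_ord.
Qed.

Lemma first_true_max v : first_true v = ord_max -> forall i, ~~ P v i.
Proof.
move=> /(congr1 (@nat_of_ord _)); rewrite first_trueE /= => e i.
have : ~~ has (P v) (enum 'I_n.+1) by rewrite has_find e size_enum_ord ltnn.
by move/hasPn; apply; rewrite mem_enum.
Qed.

Lemma first_true_at v (i : 'I_n.+1) : first_true v = i :> nat -> P v i.
Proof.
rewrite first_trueE => e.
have : has (P v) (enum 'I_n.+1) by rewrite has_find e size_enum_ord.
by move/(nth_find ord0); rewrite e nth_ord_enum.
Qed.

Lemma first_true_before v (i : 'I_n.+1) : (i < first_true v)%N -> ~~ P v i.
Proof.
rewrite first_trueE => /(before_find ord0).
by rewrite nth_ord_enum => ->.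
Qed.

Lemma first_true_le v (i : 'I_n.+1) : P v i -> (first_true v <= i)%N.
Proof. by move=> h; rewrite leqNgt; apply: contraL h => /first_true_before. Qed.
End FirstTrue.

Section Kuhn.
Variables (n q : nat).
Notation vertex := {ffun 'I_n.+1 -> 'I_q.*2.+2}.
Notation simplex := (vertex * 'S_n.+1)%type.

Let low (v : vertex) (i : 'I_n.+1) := (v i <= q)%N.
Let flat (s : simplex) := [forall x, s.1 x < q.*2.+1]%N.
Let s0 : simplex := ([ffun=> inord q], 1%g).

Lemma vtx_flat (s : simplex) (x : 'I_n.+1) j : (s.1 x < q.*2.+1)%N ->
  vtx s j x = (s.1 x + (s.2 x < j))%N :> nat.
Proof.
rewrite ffunE => h; case: (_ < j)%N; last by rewrite addr0 addn0.
by rewrite /= [(1 %% _)%N]modn_small // modn_small // addn1.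
Qed.

(** When P v i says that v i is in the lower half, labels increase along a chain.
    A fully labelled chain therefore has label j at its vertex j, which fixes
    the starting point and the order of the steps. *)
Lemma full_low (s : simplex) : flat s -> full (first_true low) s = (s == s0).
Proof.
move=> /forallP fl; apply/injectiveP/eqP; last first.
  move=> -> i j; suff H k : first_true low (vtx s0 (k : 'I_n.+2)) = k by rewrite !H.
  have vE x : vtx s0 k x = (q + (x < k))%N :> nat.
    by rewrite vtx_flat /= ffunE inordK ?perm1//; lia.
  apply/val_inj/eqP; rewrite eqn_leq /=; apply/andP; split.
    have [kn|kn] := ltnP k n.+1.
      apply: (@first_true_le _ _ low _ (Ordinal kn)).
      by rewrite /low vE /= ltnn addn0.
    by apply: leq_trans kn; rewrite -ltnS.
  rewrite leqNgt; apply/negP => h.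
  have kn : (first_true low (vtx s0 k) < n.+1)%N by have := ltn_ord k; lia.
  have := @first_true_at _ _ low (vtx s0 k) (Ordinal kn) erefl.
  by rewrite /low vE /= h; lia.
move=> inj; have : forall k : 'I_n.+2, first_true low (vtx s k) = k.
  apply: (homo_inj_ord_id inj) => i j ij.
  have [jn|jn] := ltnP (first_true low (vtx s j)) n.+1; last first.
    by apply: leq_trans jn; rewrite -ltnS.
  have := @first_true_at _ _ low (vtx s j) (Ordinal jn) erefl => h.
  apply: (@first_true_le _ _ low _ (Ordinal jn)).
  apply: leq_trans h; rewrite !vtx_flat ?fl//.
  by rewrite leq_add2l; case: ltnP => // h; rewrite (leq_trans h).
move=> lab.
have key (x : 'I_n.+1) : s.1 x = q :> nat /\ s.2 x = x.
  have xn : (x < n.+2)%N by exact: (leq_trans (ltn_ord x)).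
  have xn' : (x.+1 < n.+2)%N by rewrite ltnS.
  have /(congr1 (@nat_of_ord _)) h1 := lab (Ordinal xn).
  have /(congr1 (@nat_of_ord _)) h2 := lab (Ordinal xn').
  have := @first_true_at _ _ low (vtx s x) x h1.
  have := @first_true_before _ _ low (vtx s x.+1) x.
  rewrite h2 /= ltnSn => /(_ isT).
  rewrite /low !vtx_flat// -ltnNge => h3 h4.
  have h5 : s.2 x = x :> nat by lia.
  split; [lia|exact: val_inj].
rewrite [s]surjective_pairing; congr (_, _).
  apply/ffunP => x; rewrite ffunE; apply/val_inj => /=.
  by rewrite inordK; [case: (key x)|lia].
by apply/permP => x; rewrite perm1; case: (key x).
Qed.

(** Kuhn's form of Sperner's lemma.  Near the boundary of the cube, P agrees with
    the predicate [low], so the two labellings have the same fully labelled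
    simplices among those that wrap around the torus.  Both numbers of fully
    labelled simplices are even, and [low] has exactly one that does not wrap
    around; hence P has at least one. *)
Theorem kuhn_cube (P : vertex -> 'I_n.+1 -> bool) :
  (forall v : vertex, (exists i, v i = ord0 \/ v i = ord_max) -> P v =1 low v) ->
  exists b : vertex, let near_b (u : vertex) := forall i, (b i <= u i <= b i + 1)%N in
    (exists2 u, near_b u & forall i, ~~ P u i) /\
    (forall i, exists2 u, near_b u & P u i).
Proof.
move=> bdry.
have [/existsP[s /andP[/forallP fl /injectiveP inj]]|/existsPn none] :=
    boolP [exists s, flat s && full (first_true P) s].
  have near i k : (s.1 i <= vtx s k i <= s.1 i + 1)%N.
    by rewrite vtx_flat ?fl// leq_addr leq_add2l leq_b1.
  pose k (i : 'I_n.+2) := invF inj i.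
  have kE i : first_true P (vtx s (k i)) = i by exact: (f_invF inj).
  exists s.1 => /=; split.
    exists (vtx s (k ord_max)) => //.
    exact: first_true_max.
  move=> i; exists (vtx s (k (widen_ord (leqnSn _) i))) => //.
  by apply: first_true_at; rewrite kE.
have := even_full (first_true P).
suff -> : [set s | full (first_true P) s] = [set s | full (first_true low) s] :\ s0.
  have : s0 \in [set s | full (first_true low) s].
    rewrite inE full_low// /flat; apply/forallP => x.
    by rewrite ffunE inordK; lia.
  have := even_full (first_true low) => /= e0 h.
  rewrite (cardsD1 s0) h add1n /= negbK in e0 => e1.
  by rewrite e0 in e1.
apply/setP => s; rewrite !inE.
have [fl|/forallPn[x]] := boolP (flat s).
  rewrite full_low// andNb; apply/negbTE.
  by have := none s; rewrite fl.
rewrite -leqNgt => xm; have xE : s.1 x = ord_max.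
  by apply/val_inj/eqP; rewrite eqn_leq /= xm andbT -ltnS; exact: ltn_ord.
have -> : s != s0.
  apply/eqP => /(congr1 (fun s : simplex => (s.1 x : nat))).
  rewrite xE ffunE inordK /= -?addnn; last by rewrite ltnS leqW// leq_addr.
  by move/eqP; rewrite -addSn -[X in _ == X]add0n eqn_add2r.
have E j : first_true P (vtx s j) = first_true low (vtx s j).
  rewrite /first_true (eq_find (bdry _ _))//; exists x; rewrite ffunE xE.
  case: ltnP => _; [left|right; by rewrite addr0].
  by apply/val_inj; rewrite /= [(1 %% _)%N]modn_small // addn1 modnn.
by rewrite /full; apply/injectiveP/injectiveP => h i j; move: (h i j); rewrite !E.
Qed.
End Kuhn.
End Combinatorics.

Local Open Scope classical_set_scope.
Local Open Scope ring_scope.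

(** * Fixed points of maps on boxes and on sequences *)
Definition clamp (R : realDomainType) (lo hi x : R) : R := Num.max lo (Num.min hi x).

Section Clamp.
Variable R : realDomainType.
Implicit Types lo hi x y : R.

Lemma clamp_itv lo hi x : lo <= hi -> lo <= clamp lo hi x <= hi.
Proof. by move=> h; rewrite /clamp le_max lexx /= ge_max h ge_min lexx. Qed.

Lemma clamp_id lo hi x : lo <= x <= hi -> clamp lo hi x = x.
Proof. by move=> /andP[h1 h2]; rewrite /clamp min_r// max_r. Qed.

Lemma clamp_dist lo hi x y : lo <= hi -> `|clamp lo hi x - clamp lo hi y| <= `|x - y|.
Proof.
move=> h; have h1 := ler_norm (x - y).
have h2 : y - x <= `|x - y| by rewrite distrC ler_norm.
rewrite ler_norml /clamp /Order.max /Order.min.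
case: (ltrP hi x) => ?; case: (ltrP hi y) => ?; case: (ltrP lo x) => ?;
case: (ltrP lo y) => ?; case: (ltrP lo hi) => ?; apply/andP; split; lra.
Qed.
End Clamp.

(** Brouwer's theorem for a Lipschitz map, up to an error e.  The map is deformed
    to the constant 1/2 away from the unit cube; the deformation [ft] still has
    values in the cube, so near any of its approximate fixed points it is close to
    f.  Label a grid point x by the first coordinate with x i < ft x i: points
    with all labels inside one small cell make ft x - x small. *)
Lemma brouwer_approx (R : realType) n (f : ('I_n.+1 -> R) -> ('I_n.+1 -> R)) (L : R) :
  0 <= L -> (forall x i, 0 <= f x i <= 1) ->
  (forall x y (d : R), (forall j, `|x j - y j| <= d) -> forall i, `|f x i - f y i| <= L * d) ->
  forall e : R, 0 < e -> exists x, forall i, `|f x i - x i| <= e.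
Proof.
move=> L0 f01 fL e e0.
pose out (x : 'I_n.+1 -> R) : R := \sum_i `|x i - clamp 0 1 (x i)|.
pose rho x : R := Num.max 0 (1 - out x).
pose ft x i : R := 2^-1 + rho x * (f x i - 2^-1).
pose N : R := n.+1%:R.
have N0 : 1 <= N by rewrite ler1n.
have out0 x : 0 <= out x by apply: sumr_ge0.
have rho01 x : 0 <= rho x <= 1.
  by rewrite /rho le_max lexx /= ge_max ler01 /=; have := out0 x => ?; lra.
have outL x y (d : R) : (forall j, `|x j - y j| <= d) -> `|out x - out y| <= N * (2 * d).
  move=> xy; rewrite /out -sumrB (le_trans (ler_norm_sum _ _ _))//.
  rewrite /N -[X in X%:R]card_ord -sum1_card natr_sum mulr_suml; apply: ler_sum => j _.
  rewrite mul1r (le_trans (ler_dist_dist _ _))//.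
  have := xy j; have := clamp_dist (x j) (y j) (@ler01 R).
  set a := x j; set b := y j; set a' := clamp _ _ _; set b' := clamp _ _ _ => h1 h2.
  have -> : a - a' - (b - b') = (a - b) - (a' - b') by ring.
  by rewrite (le_trans (ler_normB _ _))//; lra.
have rhoL x y (d : R) : (forall j, `|x j - y j| <= d) -> `|rho x - rho y| <= N * (2 * d).
  move=> /outL; rewrite /rho !ler_norml => /andP[h1 h2].
  have := out0 x; have := out0 y => ? ?.
  by rewrite /Order.max; do ![case: ltrP => ?]; apply/andP; split; lra.
pose L' := L + 2 * N.
have ftL x y (d : R) : (forall j, `|x j - y j| <= d) -> forall i, `|ft x i - ft y i| <= L' * d.
  move=> xy i; have h1 := rhoL _ _ _ xy; have h2 := fL _ _ _ xy i.
  have -> : ft x i - ft y i = rho x * (f x i - f y i) + (rho x - rho y) * (f y i - 2^-1).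
    by rewrite /ft; ring.
  rewrite (le_trans (ler_normD _ _))// !normrM /L' mulrDl lerD//.
    have /andP[r0 r1] := rho01 x; rewrite (ger0_norm r0).
    by rewrite (le_trans _ h2)// ler_piMl.
  have h3 : `|f y i - 2^-1| <= 1.
    by rewrite ler_norml; have /andP[? ?] := f01 y i; apply/andP; split; lra.
  by rewrite (le_trans (ler_pM _ _ h1 h3))//; lra.
pose C := (N + 1) * (L' + 1).
have L'0 : 0 <= L' by rewrite /L'; lra.
have C0 : 0 < C by rewrite /C mulr_gt0//; lra.
pose q := (Num.truncn (5 * C / e)).+2.
have [M MqE] : {M : R | M = q.*2.+2%:R} by exists q.*2.+2%:R.
have M5 : 5 <= M by rewrite MqE ler_nat; lia.
have ME : M = 2 * q%:R + 2 by rewrite MqE -addn2 natrD -muln2 natrM; ring.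
have M0 : 0 < M by lra.
have CM : C * (5 / M) <= e.
  have := truncnS_gt (5 * C / e); rewrite ltr_pdivrMr// => h.
  have h3 : (Num.truncn (5 * C / e)).+1%:R <= M by rewrite MqE ler_nat /q; lia.
  rewrite mulrA ler_pdivrMr// mulrC (le_trans (ltW h))// mulrC.
  by rewrite ler_pM2l.
pose pos (v : {ffun 'I_n.+1 -> 'I_q.*2.+2}) i : R := -2 + 5 * (v i)%:R / M.
(* The grid covers [-2, 3], so that ft is constant near its boundary. *)
pose P v i := pos v i < ft (pos v) i.
have rho0 x i : x i <= -1 \/ 2 <= x i -> rho x = 0.
  move=> xi; suff h : 1 <= out x.
    by rewrite /rho; apply/eqP; rewrite eq_le ge_max le_max lexx /=; lra.
  rewrite /out (bigD1 i)//= ler_wpDr ?sumr_ge0//.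
  case: xi => xi; rewrite ler_normr.
    have -> : clamp 0 1 (x i) = 0 by rewrite /clamp min_r ?max_l//; lra.
    by apply/orP; right; lra.
  have -> : clamp 0 1 (x i) = 1 by rewrite /clamp min_l ?max_r//; lra.
  by apply/orP; left; lra.
have [|b [[u ub uP] wP]] := @kuhn_cube n q P.
  move=> v [i vi] j; have r0 : rho (pos v) = 0.
    apply: (rho0 _ i); rewrite /pos; case: vi => ->; [left|right].
      by rewrite mulr0 mul0r /=; lra.
    have -> : (@ord_max q.*2.+1 : nat)%:R = M - 1 :> R.
      by rewrite MqE /= -[in RHS]natr1 addrK.
    have h5 : 5 / M <= 1 by rewrite ler_pdivrMr// mul1r.
    by rewrite mulrBr mulr1 mulrBl mulfK ?gt_eqF//; lra.
  rewrite /P /ft r0 mul0r addr0 /pos.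
  have -> : (-2 + 5 * (v j)%:R / M < 2^-1) = ((v j)%:R < M / 2).
    rewrite -[in RHS](ltr_pM2r (_ : 0 < 5 / M)) ?divr_gt0//.
    have -> : M / 2 * (5 / M) = 5 / 2 by field; rewrite gt_eqF.
    by rewrite mulrCA mulrA; apply/idP/idP => ?; lra.
  rewrite ME -ltnS -(ltr_nat R) -(natr1 q); congr (_ < _); lra.
pose d : R := 5 / M.
have d0 : 0 < d by rewrite divr_gt0.
have near_pos (w w' : {ffun 'I_n.+1 -> 'I_q.*2.+2}) : (forall i, b i <= w i <= b i + 1)%N ->
    (forall i, b i <= w' i <= b i + 1)%N -> forall j, `|pos w j - pos w' j| <= d.
  move=> h h' j.
  have -> : pos w j - pos w' j = d * ((w j)%:R - (w' j)%:R) by rewrite /pos /d; ring.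
  rewrite normrM (gtr0_norm d0) ler_piMr ?(ltW d0)//.
  have /andP[] := h j; have /andP[] := h' j.
  rewrite -!(ler_nat R) !natrD ler_norml => ? ? ? ?; apply/andP; split; lra.
pose x := pos u.
have fx i : `|ft x i - x i| <= (L' + 1) * d.
  have [w wb wPi] := wP i.
  have := uP i; rewrite /P -leNgt -/x => h1.
  have := ftL _ _ _ (near_pos _ _ ub wb) i; rewrite -/x ler_norml => /andP[h2 h3].
  have := near_pos _ _ ub wb i; rewrite -/x ler_norml => /andP[h4 h5].
  by move: wPi; rewrite /P ler_norml mulrDl mul1r => h6; apply/andP; split; lra.
exists x => i; pose e' := (L' + 1) * d.
have ft01 j : 0 <= ft x j <= 1.
  have /andP[? ?] := f01 x j; have /andP[? ?] := rho01 x; rewrite /ft; nra.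
have outx : out x <= N * e'.
  rewrite /out /N -[X in X%:R]card_ord -sum1_card natr_sum mulr_suml; apply: ler_sum => j _.
  rewrite mul1r; have := fx j; have /andP[] := ft01 j.
  rewrite /clamp !ler_norml => ? ? /andP[? ?].
  case: (ltrP 1 (x j)) => ?; first by rewrite max_r//; apply/andP; split; rewrite /e'; lra.
  by case: (ltrP 0 (x j)) => ?; apply/andP; split; rewrite /e'; lra.
have rhox : 1 - rho x <= N * e'.
  by have := out0 x; rewrite /rho /Order.max => ?; case: ltrP => ?; lra.
have -> : f x i - x i = (ft x i - x i) + (1 - rho x) * (f x i - 2^-1).
  by rewrite /ft; ring.
apply: (le_trans (ler_normD _ _)); apply: le_trans CM.
have -> : C * (5 / M) = e' + N * e' by rewrite /C /e' -/d; ring.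
apply: lerD; first exact: fx.
have /andP[r0 r1] := rho01 x; have /andP[? ?] := f01 x i.
rewrite normrM ger0_norm ?subr_ge0// (le_trans _ rhox)// ler_piMr ?subr_ge0//.
by rewrite ler_norml; apply/andP; split; lra.
Qed.

(** Tychonoff's theorem in the form used below: take limits along an ultrafilter
    finer than the filter of cofinite sets. *)
Lemma pointwise_cluster (R : realType) (T : eqType) (f : nat -> T -> R) :
  (forall k x, 0 <= f k x <= 1) ->
  exists g : T -> R, forall (s : seq T) (e : R) (N : nat), 0 < e ->
    exists2 k, (N <= k)%N & forall x, x \in s -> `|f k x - g x| <= e.
Proof.
move=> f01; have [U [UU leU]] := @ultraFilterLemma nat \oo _.
have lim x : exists l : R, forall e : R, 0 < e -> U [set k | `|f k x - l| <= e].
  have F01 : (f^~ x @ U) `[0, 1]%classic.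
    apply: (@filterS _ U _ setT) => [k _|]; last exact: filterT.
    by rewrite /preimage /= in_itv /= f01.
  have [l [_ cl]] := @segment_compact R 0 1 (f^~ x @ U) _ F01.
  exists l => e e0; set A := [set k | _].
  have [//|UA] := in_ultra_setVsetC A UU; exfalso.
  have UA' : (f^~ x @ U) (f^~ x @` ~` A).
    by apply: (@filterS _ U _ (~` A)) UA => k Ak; exists k.
  have [r [[k Ak <-]]] := cl _ _ UA' (nbhsx_ballx l e e0).
  by rewrite /ball /= distrC => /ltW.
have [g gP] := choice lim; exists g => s e N e0.
have close : U [set k | forall x, x \in s -> `|f k x - g x| <= e].
  elim: s => [|y s IH].
    by apply: (@filterS _ U _ setT) => [k _ x|]; last exact: filterT.
  apply: filterS (filterI (gP y e e0) IH) => k [ky ks] x.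
  by rewrite inE => /predU1P[->//|/ks].
have large : U [set k | (N <= k)%N] by apply: leU; exact: nbhs_infty_ge.
by have [k [Nk ks]] := filter_ex (filterI large close); exists k.
Qed.

Lemma le_eps (R : realType) (K x y : R) :
  (forall e : R, 0 < e -> e <= 1 -> x <= y + K * e) -> x <= y.
Proof.
move=> h; rewrite leNgt; apply/negP => yx.
pose K' := `|K| + 1; have K0 : 0 < K' by rewrite ltr_wpDl.
pose e := Num.min 1 ((x - y) / 2 / K').
have e0 : 0 < e by rewrite lt_min ltr01 !divr_gt0// subr_gt0.
have e1 : e <= 1 by rewrite ge_min lexx.
have e2 : K' * e <= (x - y) / 2.
  by rewrite mulrC -ler_pdivlMr// /e ge_min lexx orbT.
have := h e e0 e1; have : K * e <= K' * e.
  by rewrite ler_pM2r// /K'; have := ler_norm K; lra.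
lra.
Qed.

(** A fixed point theorem of Schauder type.  The value of T at i only depends on
    the coordinates in J i, so freezing all coordinates outside a finite window
    gives a finite-dimensional problem, and T commutes with pointwise limits. *)
Theorem lattice_fixed_point (R : realType) (lo hi : int -> R)
    (T : (int -> R) -> int -> R) (J : int -> seq int) (L : R) :
  let box (z : int -> R) := forall i, lo i <= z i <= hi i in
  0 <= L ->
  (forall i, [/\ 0 <= lo i, lo i <= hi i & hi i <= 1]) ->
  (forall z, box z -> box (T z)) ->
  (forall z w i (d : R), box z -> box w ->
     (forall j, j \in J i -> `|z j - w j| <= d) -> `|T z i - T w i| <= L * d) ->
  exists2 z, box z & forall i, T z i = z i.
Proof.
move=> box L0 lohi Tbox TL.
have approx N : exists z, box z /\
    forall i, (absz i <= N)%N -> `|T z i - z i| <= N.+1%:R^-1.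
  (* The window is [-N, N]; outside of it, z is frozen at lo. *)
  pose idx (i : int) : 'I_N.*2.+1 := inord (absz (i + N%:Z)).
  pose ext (y : 'I_N.*2.+1 -> R) i :=
    if (absz i <= N)%N then clamp (lo i) (hi i) (y (idx i)) else lo i.
  have extbox y : box (ext y).
    move=> i; have [? ? ?] := lohi i; rewrite /ext; case: ifP => _.
      exact: clamp_itv.
    by rewrite lexx.
  pose f y (k : 'I_N.*2.+1) := T (ext y) (k%:Z - N%:Z).
  have [||||y yP] := @brouwer_approx R _ f L _ _ _ N.+1%:R^-1.
  - by [].
  - move=> y k; have [? ? ?] := lohi (k%:Z - N%:Z).
    by have /andP[? ?] := Tbox _ (extbox y) (k%:Z - N%:Z); rewrite /f; apply/andP; split; lra.
  - move=> y w d yw k; apply: TL => // j _; rewrite /ext; case: ifP => _.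
      have [? ? ?] := lohi j.
      by rewrite (le_trans (clamp_dist _ _ _)).
    by rewrite subrr normr0 (le_trans _ (yw ord0)).
  - by rewrite invr_gt0.
  exists (ext y); split=> // i iN.
  have := yP (idx i); rewrite /f.
  have -> : (idx i)%:Z - N%:Z = i by rewrite /idx inordK; lia.
  move=> h; have [? ? ?] := lohi i.
  rewrite -{1}(@clamp_id _ (lo i) (hi i) (T (ext y) i)); last exact: Tbox.
  by rewrite {2}/ext iN (le_trans (clamp_dist _ _ _)).
have [zs zsP] := choice approx.
have [|z zP] := @pointwise_cluster R int zs.
  move=> k i; have [/(_ i) /andP[? ?] _] := zsP k; have [? ? ?] := lohi i.
  by apply/andP; split; lra.
have zbox : box z.
  move=> i; apply/andP; split; apply: (@le_eps _ 1) => e e0 _;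
    have [k _ /(_ i)] := zP [:: i] e 0%N e0; rewrite inE eqxx => /(_ isT);
    have [/(_ i) /andP[? ?] _] := zsP k; rewrite ler_norml => /andP[? ?]; lra.
exists z => // i; apply/eqP; rewrite -subr_eq0 -normr_le0.
apply: (@le_eps _ (L + 2)) => e e0 e1.
have [k] := zP (i :: J i) e (maxn (absz i) (Num.truncn e^-1)) e0.
rewrite geq_max => /andP[ik ek] zk.
have [zkbox /(_ i ik) h] := zsP k.
have h1 : k.+1%:R^-1 <= e.
  rewrite -[e]invrK lef_pV2 ?posrE ?invr_gt0//.
  by rewrite (le_trans (ltW (truncnS_gt _)))// ler_nat ltnS.
have h2 : `|T z i - T (zs k) i| <= L * e.
  apply: TL => // j ji; rewrite distrC; apply: zk.
  by rewrite inE ji orbT.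
have h3 : `|zs k i - z i| <= e by apply: zk; rewrite inE eqxx.
have -> : T z i - z i = (T z i - T (zs k) i) + (T (zs k) i - zs k i) + (zs k i - z i) by ring.
apply: (le_trans (ler_normD _ _)).
have := ler_normD (T z i - T (zs k) i) (T (zs k) i - zs k i); move: (le_trans h h1) => {h h1}; lra.
Qed.

(** * The nonlinearity *)

(** The consequences of (H1)-(H3) that the existence of waves and their
    nonexistence depend on, with explicit constants. *)
Record regular_rate (R : realType) (g : R -> R -> R) (K G : R) : Prop := RegularRate {
  rate_lip : forall a b a' b' : R, 0 <= a <= 1 -> 0 <= b <= 1 -> 0 <= a' <= 1 -> 0 <= b' <= 1 ->
    `|g a b - g a' b'| <= K * (`|a - a'| + `|b - b'|);
  rate_nincr : forall a b a' b' : R, 0 <= a -> a <= a' -> a' <= 1 ->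
    0 <= b -> b <= b' -> b' <= 1 -> g a' b' <= g a b;
  rate_bound : forall a b : R, 0 <= a <= 1 -> 0 <= b <= 1 -> `|g a b| <= G;
  rate_K : 0 < K;
  rate_10 : g 1 0 = 0;
  rate_01 : 0 < g 0 1
}.

Lemma regular_rate_exists (R : realType) (g : R -> R -> R) (E : R) :
  H1 g -> H2 g -> H3 g E -> exists K G, regular_rate g K G.
Proof.
move=> [g10 _] [lip dec1 dec2 _] [g01 _ _].
have [K [K0 KP]] : exists K : R, 0 < K /\ forall a b a' b' : R,
    0 <= a <= 1 -> 0 <= b <= 1 -> 0 <= a' <= 1 -> 0 <= b' <= 1 ->
    `|g a b - g a' b'| <= K * (`|a - a'| + `|b - b'|).
  have [M [_ /(_ (`|M| + 1))]] := lip.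
  have M1 : M < `|M| + 1 by rewrite ltr_pwDr// ler_norm.
  move=> /(_ M1) h; exists (`|M| + 1); split; first by rewrite ltr_wpDl.
  move=> a b a' b' ha hb ha' hb'.
  have /= := h ((a, b), (a', b')) (conj (conj ha hb) (conj ha' hb')).
  move=> /le_trans; apply; rewrite ler_pM2l ?ltr_wpDl//.
  by rewrite prod_normE /= ge_max lerDl lerDr !normr_ge0.
have mono a b a' b' : 0 <= a -> a <= a' -> a' <= 1 -> 0 <= b -> b <= b' -> b' <= 1 ->
    g a' b' <= g a b.
  move=> a0 aa a1 b0 bb b1; apply: (@le_trans _ _ (g a b')).
    move: aa; rewrite le_eqVlt => /predU1P[->//|aa].
    by apply/ltW/dec1 => //; rewrite b1 (le_trans b0).
  move: bb; rewrite le_eqVlt => /predU1P[->//|bb].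
  by apply/ltW/dec2 => //; rewrite a0 (le_trans aa).
exists K, (`|g 0 0| + `|g 1 1|); split => // a b /andP[? ?] /andP[? ?].
have h1 : g a b <= g 0 0 by apply: mono; lra.
have h2 : g 1 1 <= g a b by apply: mono; lra.
have := ler_norm (g 0 0); have := ler_norm (- g 1 1); rewrite normrN => ? ?.
have := normr_ge0 (g 0 0); have := normr_ge0 (g 1 1) => ? ?.
by rewrite ler_norml; apply/andP; split; lra.
Qed.

Section Reaction.
Variables (R : realType) (D : R) (g : R -> R -> R) (K G : R).
Implicit Types a b m v u : R.

Lemma rate_G_ge0 : regular_rate g K G -> 0 <= G.
Proof. move=> gP; by rewrite (le_trans _ (rate_bound gP (a := 0) (b := 0) _ _)) ?lexx ?ler01. Qed.

(** Monotonicity with an error: move a and b up to max(a, a') and max(b, b'), which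
    are within e of a' and b'. *)
Lemma rate_ge_approx a b a' b' e : regular_rate g K G ->
  0 <= a <= 1 -> 0 <= b <= 1 -> 0 <= a' <= 1 -> 0 <= b' <= 1 ->
  0 <= e -> a <= a' + e -> b <= b' + e -> g a' b' - 2 * K * e <= g a b.
Proof.
move=> gP /andP[? ?] /andP[? ?] /andP[? ?] /andP[? ?] e0 aa bb.
have ub x y : x <= 1 -> y <= 1 -> x <= y + e ->
    exists z, [/\ x <= z, y <= z, z <= 1 & z <= y + e].
  move=> ? ? ?; exists (Num.max x y).
  by rewrite !le_max !lexx orbT !ge_max; split=> //; apply/andP; split; lra.
have [//|//|//|m [am am' m1 me]] := ub a a'.
have [//|//|//|n [bn bn' n1 ne]] := ub b b'.
have h1 : g m n <= g a b by apply: (rate_nincr gP); lra.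
have h2 : `|g m n - g a' b'| <= K * (`|m - a'| + `|n - b'|).
  by apply: (rate_lip gP); apply/andP; split; lra.
have h3 : K * (`|m - a'| + `|n - b'|) <= K * (2 * e).
  rewrite ler_pM2l ?(rate_K gP)// !ger0_norm ?subr_ge0//; lra.
by move: h2; rewrite ler_norml => /andP[? _]; lra.
Qed.

(** The right-hand side of the lattice equation, where a and b are the values at the
    two neighbours, m is the value itself and v the delayed value. *)
Definition local_rhs a b m v : R := D * (a + b - 2 * m) + m * g m v.

Lemma local_rhs_le a b m v : 0 < D -> regular_rate g K G ->
  0 <= a <= 1 -> 0 <= b <= 1 -> 0 <= m <= 1 -> 0 <= v <= 1 ->
  `|local_rhs a b m v| <= 2 * D + G.
Proof.
move=> D0 gP /andP[? ?] /andP[? ?] hm hv; have G0 := rate_G_ge0 gP; have := rate_bound gP hm hv.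
case/andP: hm => m0 m1; rewrite /local_rhs !ler_norml => /andP[? ?].
have ? : m * g m v <= G by have : m * (G - g m v) >= 0; [rewrite mulr_ge0//; lra|nra].
have ? : - G <= m * g m v by have : m * (G + g m v) >= 0; [rewrite mulr_ge0//; lra|nra].
have ? : 0 <= D * (2 - (a + b - 2 * m)) by rewrite mulr_ge0//; lra.
have ? : 0 <= D * (2 + (a + b - 2 * m)) by rewrite mulr_ge0//; lra.
by apply/andP; split; lra.
Qed.

Lemma local_rhs_dist a b m v a' b' m' v' (d : R) :
  0 < D -> regular_rate g K G ->
  0 <= m <= 1 -> 0 <= v <= 1 -> 0 <= m' <= 1 -> 0 <= v' <= 1 ->
  `|a - a'| <= d -> `|b - b'| <= d -> `|m - m'| <= d -> `|v - v'| <= d ->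
  `|local_rhs a b m v - local_rhs a' b' m' v'| <= (4 * D + G + 2 * K) * d.
Proof.
move=> D0 gP hm hv hm' hv' ha hb hmm hvv.
have -> : local_rhs a b m v - local_rhs a' b' m' v' = D * ((a - a') + (b - b') - 2 * (m - m'))
   + ((m - m') * g m v + m' * (g m v - g m' v')) by rewrite /local_rhs; ring.
have h1 : `|D * ((a - a') + (b - b') - 2 * (m - m'))| <= D * (4 * d).
  rewrite normrM gtr0_norm// ler_pM2l//; move: ha hb hmm.
  by rewrite !ler_norml => /andP[? ?] /andP[? ?] /andP[? ?]; apply/andP; split; lra.
have h2 : `|(m - m') * g m v| <= d * G by rewrite normrM ler_pM// (rate_bound gP).
have h3 : `|m' * (g m v - g m' v')| <= 1 * (K * (d + d)).
  rewrite normrM ler_pM//; first by rewrite ger0_norm; case/andP: hm'.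
  rewrite (le_trans (rate_lip gP hm hv hm' hv'))// ler_pM2l ?(rate_K gP)//.
  exact: lerD.
rewrite (le_trans (ler_normD _ _))// (le_trans (lerD h1 (ler_normD _ _)))//.
by lra.
Qed.

(** The damping G + K makes the growth term monotone in u, which is what barriers
    require; in the delayed argument v it stays decreasing. *)
Lemma damped_growth_homo u u' v : regular_rate g K G -> 0 <= u -> u <= u' -> u' <= 1 -> 0 <= v <= 1 ->
  (G + K) * u + u * g u v <= (G + K) * u' + u' * g u' v.
Proof.
move=> gP u0 uu u1 hv.
have hu : 0 <= u <= 1 by apply/andP; split; lra.
have hu' : 0 <= u' <= 1 by apply/andP; split; lra.
have := rate_lip gP hu hv hu' hv.
rewrite subrr normr0 addr0 [`|u - u'|]ler0_norm; last lra.
rewrite ler_norml => /andP[_ h1].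
have := rate_bound gP hu' hv; rewrite ler_norml => /andP[h2 _].
have h3 : 0 <= (u' - u) * (G + g u' v) by apply: mulr_ge0; lra.
have h4 : g u' v <= g u v by apply: (rate_nincr gP) => //; case/andP: hv.
have h5 : u * (g u v - g u' v) <= 1 * (g u v - g u' v).
  by rewrite ler_wpM2r ?subr_ge0//; lra.
lra.
Qed.
End Reaction.

(** * Waves of the discretised equation *)

(** [drift] is c mu for the wave equation and A (1 - e^{- mu h}) when the term
    c phi' is replaced by A (phi x - phi (x - h)). *)
Definition dispersion (R : realType) (D g0 mu drift : R) : R :=
  D * (expR mu + expR (- mu) - 2) + g0 - drift.

Definition upper_barrier (R : realType) (lam x : R) : R := Num.min 1 (expR (lam * x)).

Definition lower_barrier (R : realType) (lam eta q x : R) : R :=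
  Num.max 0 (expR (lam * x) - q * expR (eta * x)).

Section Barriers.
Variables (R : realType).
Implicit Types lam eta q x : R.

Lemma upper_barrier_le1 lam x : upper_barrier lam x <= 1.
Proof. by rewrite ge_min lexx. Qed.

Lemma upper_barrier_leexp lam x : upper_barrier lam x <= expR (lam * x).
Proof. by rewrite ge_min lexx orbT. Qed.

Lemma lower_barrier_ge0 lam eta q x : 0 <= lower_barrier lam eta q x.
Proof. by rewrite le_max lexx. Qed.

Lemma lower_barrier_ge lam eta q x :
  expR (lam * x) - q * expR (eta * x) <= lower_barrier lam eta q x.
Proof. by rewrite le_max lexx orbT. Qed.

(** On the support of the lower barrier the quadratic error of the linearisation,
    of size e^{2 lam x}, is dominated by e^{eta x}. *)
Lemma lower_barrier_pos lam eta q x : 0 < lam -> lam < eta -> eta <= 2 * lam -> 1 <= q ->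
  0 < expR (lam * x) - q * expR (eta * x) ->
  [/\ x < 0, expR (lam * x) <= 1 & expR (lam * x) ^+ 2 <= expR (eta * x)].
Proof.
move=> l0 le el q1 h.
have x0 : x < 0.
  rewrite ltNge; apply/negP => x0.
  have h1 : expR (lam * x) <= expR (eta * x) by rewrite ler_expR ler_wpM2r// ltW.
  have h2 : 0 <= (q - 1) * expR (eta * x) by rewrite mulr_ge0 ?expR_ge0//; lra.
  lra.
split => //.
  by rewrite -expR0 ler_expR; nra.
by rewrite expr2 -expRD ler_expR; nra.
Qed.

Lemma lower_le_upper lam eta q x : 0 < lam -> lam < eta -> eta <= 2 * lam -> 1 <= q ->
  lower_barrier lam eta q x <= upper_barrier lam x.
Proof.
move=> l0 le el q1; rewrite /lower_barrier ge_max; apply/andP; split.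
  by rewrite le_min ler01 expR_ge0.
have [h|h] := lerP (expR (lam * x) - q * expR (eta * x)) 0.
  by rewrite (le_trans h)// le_min ler01 expR_ge0.
have [_ p1 _] := lower_barrier_pos l0 le el q1 h.
have h2 : 0 <= q * expR (eta * x) by rewrite mulr_ge0 ?expR_ge0//; lra.
by rewrite le_min; apply/andP; split; lra.
Qed.
End Barriers.

(** The equation is solved for z i after adding a damping term on both sides; call
    the resulting map T.  It preserves the order interval between the barriers.
    The number 1 is a supersolution as g(1,0) = 0, and e^{lam x} is one as
    g <= g(0,0) and lam is a root of the dispersion relation.  For the lower
    barrier, the delayed value is at most e^{lam x} because a delay moves x to
    the left, and the loss 2 K e^{2 lam x} is paid for by the term with eta. *)
Theorem discrete_wave (R : realType) (D : R) (g : R -> R -> R) (K G : R)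
    (A h lam eta q : R) (M r : nat) :
  0 < D -> regular_rate g K G -> 0 < A -> 0 < h -> M%:R * h = 1 ->
  0 < lam -> lam < eta -> eta <= 2 * lam -> 1 <= q ->
  dispersion D (g 0 0) lam (A * (1 - expR (- (lam * h)))) = 0 ->
  2 * K <= - (q * dispersion D (g 0 0) eta (A * (1 - expR (- (eta * h))))) ->
  exists2 z : int -> R,
    forall i, lower_barrier lam eta q (i%:~R * h) <= z i <= upper_barrier lam (i%:~R * h) &
    forall i, A * (z i - z (i - 1)) =
      local_rhs D g (z (i + M%:Z)) (z (i - M%:Z)) (z i) (z (i - r%:Z)).
Proof.
move=> D0 gP A0 h0 Mh l0 le el q1 dl de.
have G0 := rate_G_ge0 gP; have K0 := rate_K gP.
pose S := A + 2 * D + (G + K).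
have S0 : 0 < S by rewrite /S; lra.
pose T (z : int -> R) i := (A * z (i - 1) + D * z (i + M%:Z) + D * z (i - M%:Z) +
  ((G + K) * z i + z i * g (z i) (z (i - r%:Z)))) / S.
pose lo (i : int) := lower_barrier lam eta q (i%:~R * h).
pose hi (i : int) := upper_barrier lam (i%:~R * h).
have lohi i : [/\ 0 <= lo i, lo i <= hi i & hi i <= 1].
  by split; [exact: lower_barrier_ge0|exact: lower_le_upper|exact: upper_barrier_le1].
pose L := (A + 6 * D + 2 * G + 3 * K) / S.
have L0 : 0 <= L by rewrite /L divr_ge0//; lra.
have xB i : (i - 1)%:~R * h = i%:~R * h - h :> R by rewrite intrB mulrBl mul1r.
have xDM i : (i + M%:Z)%:~R * h = i%:~R * h + 1 :> R by rewrite intrD mulrDl -pmulrn Mh.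
have xBM i : (i - M%:Z)%:~R * h = i%:~R * h - 1 :> R by rewrite intrB mulrBl -pmulrn Mh.
have z01 z : (forall i, lo i <= z i <= hi i) -> forall i, 0 <= z i <= 1.
  move=> zb i; have [? ? ?] := lohi i; have /andP[? ?] := zb i.
  by apply/andP; split; lra.
have [||||z zb zE] := @lattice_fixed_point R lo hi T
  (fun i => [:: i - 1; i + M%:Z; i - M%:Z; i; i - r%:Z]) L.
- exact: L0.
- exact: lohi.
- move=> z zb i; have zi := z01 z zb.
  have /andP[u0 u1] := zi i; have vi := zi (i - r%:Z); have /andP[v0 v1] := vi.
  pose p := expR (lam * (i%:~R * h)); pose w := expR (eta * (i%:~R * h)).
  have p0 : 0 < p by exact: expR_gt0.
  have w0 : 0 < w by exact: expR_gt0.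
  have expB mu : expR (mu * ((i - 1)%:~R * h)) = expR (mu * (i%:~R * h)) * expR (- (mu * h)).
    by rewrite xB mulrBr expRD.
  have expDM mu : expR (mu * ((i + M%:Z)%:~R * h)) = expR (mu * (i%:~R * h)) * expR mu.
    by rewrite xDM mulrDr mulr1 expRD.
  have expBM mu : expR (mu * ((i - M%:Z)%:~R * h)) = expR (mu * (i%:~R * h)) * expR (- mu).
    by rewrite xBM mulrBr mulr1 expRD.
  have zp j : z j <= expR (lam * (j%:~R * h)).
    by have /andP[_ /le_trans] := zb j; apply; exact: upper_barrier_leexp.
  have zl j : expR (lam * (j%:~R * h)) - q * expR (eta * (j%:~R * h)) <= z j.
    by have /andP[+ _] := zb j; apply: le_trans; exact: lower_barrier_ge.
  have vp : z (i - r%:Z) <= p.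
    apply: (le_trans (zp _)); rewrite ler_expR ler_wpM2l ?(ltW l0)// ler_wpM2r ?(ltW h0)//.
    by rewrite ler_int gerBl.
  have gr := rate_bound gP (zi i) vi; rewrite ler_norml in gr; case/andP: gr => gr1 gr2.
  have t1 : A * z (i - 1) <= A * 1 by rewrite ler_pM2l//; case/andP: (zi (i - 1)).
  have t2 : D * z (i + M%:Z) <= D * 1 by rewrite ler_pM2l//; case/andP: (zi (i + M%:Z)).
  have t3 : D * z (i - M%:Z) <= D * 1 by rewrite ler_pM2l//; case/andP: (zi (i - M%:Z)).
  have t1' : 0 <= A * z (i - 1) by rewrite mulr_ge0 ?(ltW A0)//; case/andP: (zi (i - 1)).
  have t2' : 0 <= D * z (i + M%:Z) by rewrite mulr_ge0 ?(ltW D0)//; case/andP: (zi (i + M%:Z)).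
  have t3' : 0 <= D * z (i - M%:Z) by rewrite mulr_ge0 ?(ltW D0)//; case/andP: (zi (i - M%:Z)).
  apply/andP; split.
    rewrite /lo /lower_barrier ge_max; apply/andP; split.
      have : 0 <= z i * ((G + K) + g (z i) (z (i - r%:Z))) by rewrite mulr_ge0//; lra.
      by move=> ?; rewrite /T divr_ge0//; lra.
    rewrite -/p -/w; have [lneg|lpos] := lerP (p - q * w) 0.
      have : 0 <= z i * ((G + K) + g (z i) (z (i - r%:Z))) by rewrite mulr_ge0//; lra.
      by move=> ?; rewrite (le_trans lneg)// /T divr_ge0//; lra.
    have [_ p1 p2] := lower_barrier_pos l0 le el q1 lpos; rewrite -/p -/w in p1 p2.
    have qw0 : 0 < q * w by rewrite mulr_gt0//; lra.
    have m1 : A * (p * expR (- (lam * h)) - q * (w * expR (- (eta * h)))) <= A * z (i - 1).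
      by rewrite ler_pM2l// /p /w -!expB.
    have m2 : D * (p * expR lam - q * (w * expR eta)) <= D * z (i + M%:Z).
      by rewrite ler_pM2l// /p /w -!expDM.
    have m3 : D * (p * expR (- lam) - q * (w * expR (- eta))) <= D * z (i - M%:Z).
      by rewrite ler_pM2l// /p /w -!expBM.
    have lz : p - q * w <= z i by exact: zl.
    have m4 := damped_growth_homo gP (ltW lpos) lz u1 vi.
    have l01 : 0 <= p - q * w <= 1 by apply/andP; split; lra.
    have h00 : 0 <= (0 : R) <= 1 by rewrite lexx ler01.
    have m5 : g 0 0 - 2 * K * p <= g (p - q * w) (z (i - r%:Z)).
      by apply: (rate_ge_approx gP l01 vi h00 h00 (ltW p0)); lra.
    have m7 : (p - q * w) * (g 0 0 - K * (2 * p)) <=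
        (p - q * w) * g (p - q * w) (z (i - r%:Z)).
      by rewrite ler_pM2l//; lra.
    have m8 : (p - q * w) * (K * (2 * p)) <= p * (K * (2 * p)).
      by rewrite ler_wpM2r ?mulr_ge0 ?(ltW K0) ?(ltW p0)//; lra.
    have m9 : 2 * K * p ^+ 2 <= 2 * K * w by rewrite ler_pM2l// mulr_gt0.
    have m10 : 2 * K * w <=
        - (q * dispersion D (g 0 0) eta (A * (1 - expR (- (eta * h))))) * w.
      by rewrite ler_pM2r.
    rewrite /T ler_pdivlMr//.
    have e1 : p * dispersion D (g 0 0) lam (A * (1 - expR (- (lam * h)))) = 0.
      by rewrite dl mulr0.
    rewrite /dispersion in e1 m10; rewrite /S; lra.
  rewrite /hi /upper_barrier le_min; apply/andP; split.
    rewrite /T ler_pdivrMr// mul1r.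
    have m1 := damped_growth_homo gP u0 u1 (lexx 1) vi.
    have m2 : g 1 (z (i - r%:Z)) <= g 1 0 by apply: (rate_nincr gP); lra.
    by rewrite (rate_10 gP) in m2; rewrite /S; lra.
  rewrite -/p /T ler_pdivrMr//.
  have m1 : A * z (i - 1) <= A * (p * expR (- (lam * h))).
    by rewrite ler_pM2l// /p -expB.
  have m2 : D * z (i + M%:Z) <= D * (p * expR lam) by rewrite ler_pM2l// /p -expDM.
  have m3 : D * z (i - M%:Z) <= D * (p * expR (- lam)) by rewrite ler_pM2l// /p -expBM.
  have m4 : g (z i) (z (i - r%:Z)) <= g 0 0 by apply: (rate_nincr gP).
  have m5 : z i * (G + K + g (z i) (z (i - r%:Z))) <= p * (G + K + g 0 0).
    have zip : z i <= p by exact: (zp i).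
    by apply: ler_pM => //; lra.
  have e1 : p * dispersion D (g 0 0) lam (A * (1 - expR (- (lam * h)))) = 0.
    by rewrite dl mulr0.
  rewrite /dispersion in e1; rewrite /S; lra.
- move=> z w i d zb wb zw.
  have hz := z01 z zb; have hw := z01 w wb.
  have d1 : `|z (i - 1) - w (i - 1)| <= d by apply: zw; rewrite !inE eqxx.
  have d2 : `|z (i + M%:Z) - w (i + M%:Z)| <= d by apply: zw; rewrite !inE eqxx ?orbT.
  have d3 : `|z (i - M%:Z) - w (i - M%:Z)| <= d by apply: zw; rewrite !inE eqxx ?orbT.
  have d4 : `|z i - w i| <= d by apply: zw; rewrite !inE eqxx ?orbT.
  have d5 : `|z (i - r%:Z) - w (i - r%:Z)| <= d by apply: zw; rewrite !inE eqxx ?orbT.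
  have dr := local_rhs_dist D0 gP (hz i) (hz (i - r%:Z)) (hw i) (hw (i - r%:Z)) d2 d3 d4 d5.
  have -> : T z i - T w i = (A * (z (i - 1) - w (i - 1)) +
      (local_rhs D g (z (i + M%:Z)) (z (i - M%:Z)) (z i) (z (i - r%:Z)) -
       local_rhs D g (w (i + M%:Z)) (w (i - M%:Z)) (w i) (w (i - r%:Z))) +
      (2 * D + (G + K)) * (z i - w i)) / S.
    by rewrite /T /local_rhs; field; rewrite gt_eqF.
  rewrite normrM normfV (gtr0_norm S0) /L mulrAC ler_pM2r ?invr_gt0//.
  have n1 : `|A * (z (i - 1) - w (i - 1))| <= A * d by rewrite normrM gtr0_norm// ler_pM2l.
  have n2 : `|(2 * D + (G + K)) * (z i - w i)| <= (2 * D + (G + K)) * d.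
    have c0 : 0 < 2 * D + (G + K) by lra.
    by rewrite normrM gtr0_norm// ler_pM2l.
  apply: (le_trans (ler_normD _ _)); apply: (le_trans (lerD (ler_normD _ _) n2)).
  apply: (le_trans (lerD (lerD n1 dr) (lexx _))); lra.
exists z => // i; have := zE i => /(congr1 (fun x => x * S)).
by rewrite /T divfK ?gt_eqF// /S /local_rhs => e; lra.
Qed.

(** * Calculus *)
Section Calculus.
Variable R : realType.
Implicit Types (f df : R -> R) (a b d m x y t : R).

Lemma is_derive_quadratic f x d (C : R) :
  (forall t, `|t| <= 1 -> `|f (x + t) - f x - t * d| <= C * t ^+ 2) ->
  is_derive x 1 f d.
Proof.
move=> h.
have cv : t^-1 *: ((f \o shift x) (t *: 1) - f x) @[t --> 0^'] --> d.
  apply/cvgrPdist_le => e e0.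
  have C1 : 0 < `|C| + 1 by rewrite ltr_wpDl.
  near=> t.
  have t0 : t != 0 by near: t; exact: nbhs_dnbhs_neq.
  have t1 : `|t| <= 1.
    by near: t; apply: dnbhs0_le.
  have t2 : `|t| <= e / (`|C| + 1).
    by near: t; apply: dnbhs0_le; rewrite divr_gt0.
  rewrite /= scaler1 [t + x]addrC -[_ *: _]/(t^-1 * _).
  have -> : d - t^-1 * (f (x + t) - f x) = - (t^-1 * (f (x + t) - f x - t * d)).
    by field.
  rewrite normrN normrM normfV ler_pdivrMl ?normr_gt0//.
  rewrite (le_trans (h t t1))// (@le_trans _ _ ((`|C| + 1) * `|t| ^+ 2))//.
    by rewrite real_normK ?num_real// ler_wpM2r ?sqr_ge0// ler_wpDr// ler_norm.
  rewrite expr2 mulrCA ler_pM2l ?normr_gt0// mulrC -ler_pdivlMr//.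
by apply: DeriveDef; [apply/cvg_ex; exists d|exact: cvg_lim].
Unshelve. all: by end_near. Qed.

Lemma is_derive_continuous f df : (forall x, is_derive x 1 f (df x)) -> continuous f.
Proof.
move=> h x; apply: differentiable_continuous; apply/derivable1_diffP.
by have [] := h x.
Qed.

Lemma mean_value f df : (forall x, is_derive x 1 f (df x)) -> forall x y, x < y ->
  exists2 t, x < t < y & f y - f x = df t * (y - x).
Proof.
move=> h x y xy; have cf := is_derive_continuous h.
have [t] := MVT xy (fun t _ => h t) (continuous_subspaceT cf).
by rewrite in_itv; exists t.
Qed.

(** Differentiability as an error estimate, which avoids one-sided limits in the
    next two lemmas. *)
Lemma is_derive_taylor f x d (e : R) : is_derive x 1 f d -> 0 < e ->
  exists2 r : R, 0 < r & forall t, `|t| < r -> `|f (x + t) - f x - t * d| <= e * `|t|.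
Proof.
move=> [dv dE] e0.
have : t^-1 *: ((f \o shift x) (t *: 1) - f x) @[t --> 0^'] --> d.
  by rewrite -dE; exact: dv.
move=> /cvgrPdist_le/(_ e e0)/nbhs_ballP[r /= r0 h]; exists r => // t tr.
have [->|t0] := eqVneq t 0; first by rewrite addr0 subrr mul0r subr0 normr0 mulr0.
have := h t; rewrite /ball /= sub0r normrN => /(_ tr t0).
rewrite scaler1 [t + x]addrC -[_ *: _]/(t^-1 * _) => h1.
have -> : f (x + t) - f x - t * d = - (t * (d - t^-1 * (f (x + t) - f x))) by field.
by rewrite normrN normrM mulrC ler_pM2r// normr_gt0.
Qed.

Lemma derive_ge0_at_left_max f a m d : is_derive m 1 f d -> a < m ->
  (forall s, a <= s <= m -> f s <= f m) -> 0 <= d.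
Proof.
move=> dm am h; apply: (@le_eps _ 1) => e e0 _; rewrite mul1r.
have [r r0 hr] := is_derive_taylor dm e0.
have [t [t0 tr tma]] : exists t, [/\ 0 < t, t < r & t <= m - a].
  exists (Num.min (r / 2) (m - a)); rewrite lt_min gt_min ge_min lexx orbT.
  split=> //; first by apply/andP; split; lra.
  by apply/orP; left; lra.
have := hr (- t); rewrite normrN gtr0_norm// => /(_ tr).
have hm : f (m - t) <= f m by apply: h; apply/andP; split; lra.
rewrite ler_norml => /andP[h1 _]; have h2 : - e * t <= t * d by lra.
by rewrite mulrC ler_pM2l// in h2; lra.
Qed.

Lemma derive_le0_at_left_min f a m d : is_derive m 1 f d -> a < m ->
  (forall s, a <= s <= m -> f m <= f s) -> d <= 0.
Proof.
move=> dm am h; rewrite -oppr_ge0.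
have dN : is_derive m 1 (- f) (- d) by exact: is_deriveN.
by apply: (derive_ge0_at_left_max dN am) => s /h; rewrite !fctE lerN2.
Qed.

(** The function cannot stay above a, since it would decrease at least linearly.
    Nor can it return there: its maximum over the time elapsed would be a point
    above a at which the slope is nonnegative. *)
Lemma eventually_le f df a (X delta : R) :
  (forall x, is_derive x 1 f (df x)) -> 0 < delta ->
  (forall x, X <= x -> a <= f x -> df x <= - delta) ->
  exists Y, forall x, Y <= x -> f x <= a.
Proof.
move=> dP d0 h.
have [x1 x1X fx1] : exists2 x, X <= x & f x < a.
  apply: contrapT => hn.
  have {}hn x : X <= x -> a <= f x.
    by move=> Xx; rewrite leNgt; apply/negP => fx; apply: hn; exists x.
  pose y := X + (f X - a + 1) / delta.
  have fXa := hn X (lexx _).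
  have Xy : X < y by rewrite /y ltrDl divr_gt0//; lra.
  have [t /andP[Xt _] e] := mean_value dP Xy.
  have := hn y (ltW Xy); have := h t (ltW Xt) (hn t (ltW Xt)) => h1 h2.
  have h3 : df t * (y - X) <= - delta * (y - X) by rewrite ler_wpM2r//; lra.
  have h4 : - delta * (y - X) = - (f X - a + 1).
    by rewrite /y addrC addKr mulNr mulrC divfK ?gt_eqF.
  lra.
exists x1 => x x1x; rewrite leNgt; apply/negP => fx.
have [m] := EVT_max x1x (continuous_subspaceT (is_derive_continuous dP)).
rewrite in_itv /= => /andP[m1 m2] hm.
have fm : a < f m by rewrite (lt_le_trans fx)// hm// in_itv /= x1x lexx.
have x1m : x1 < m.
  rewrite lt_neqAle m1 andbT; apply: contraTneq fm => <-.
  by rewrite -leNgt ltW.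
have : 0 <= df m.
  apply: (derive_ge0_at_left_max (dP m) x1m) => s /andP[s1 s2].
  by apply: hm; rewrite in_itv /= s1 (le_trans s2).
have := h m (le_trans x1X m1) (ltW fm); lra.
Qed.

Lemma eventually_ge f df a (X delta : R) :
  (forall x, is_derive x 1 f (df x)) -> 0 < delta ->
  (forall x, X <= x -> f x <= a -> delta <= df x) ->
  exists Y, forall x, Y <= x -> a <= f x.
Proof.
move=> dP d0 h.
have dN x : is_derive x 1 (- f) (- df x) by exact: is_deriveN.
have [|Y hY] := @eventually_le (- f) (fun x => - df x) (- a) X delta dN d0.
  by move=> x Xx; rewrite !fctE !lerN2; exact: h.
by exists Y => x /hY; rewrite !fctE lerN2.
Qed.
End Calculus.

(** * Profiles and limits of approximate profiles *)
Section Profiles.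
Variables (R : realType) (D tau : R) (g : R -> R -> R) (K G : R).
Implicit Types (phi : R -> R) (c x y e : R).
Local Notation B := (2 * D + G).
Local Notation Lf := (4 * D + G + 2 * K).

Definition wave_rhs c phi x : R :=
  local_rhs D g (phi (x + 1)) (phi (x - 1)) (phi x) (phi (x - c * tau)).

(** The bounds 0 and 1 keep the arguments of g in the square on which it is
    Lipschitz and decreasing. *)
Definition profile c phi : Prop :=
  (forall x, 0 <= phi x <= 1) /\ forall x, is_derive x 1 phi (wave_rhs c phi x / c).

Lemma profile_lip c phi : 0 < D -> regular_rate g K G -> 0 < c -> profile c phi ->
  forall x y, `|phi x - phi y| <= B / c * `|x - y|.
Proof.
move=> D0 gP c0 [p01 dphi].
suff H x y : x < y -> `|phi x - phi y| <= B / c * `|x - y|.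
  move=> x y; case: (ltgtP x y) => [/H//|/H|->]; first by rewrite distrC [`|y - x|]distrC.
  by rewrite !subrr normr0 mulr0.
move=> xy; have [t _ e] := mean_value dphi xy.
rewrite distrC [`|x - y|]distrC e normrM ler_wpM2r// normrM normfV (gtr0_norm c0).
by rewrite ler_pM2r ?invr_gt0//; apply: (local_rhs_le (K := K)).
Qed.

Lemma wave_rhs_lip c phi : 0 < D -> regular_rate g K G -> 0 < c -> profile c phi ->
  forall x y, `|wave_rhs c phi x - wave_rhs c phi y| <= Lf * (B / c * `|x - y|).
Proof.
move=> D0 gP c0 [p01 dphi] x y; have pl := profile_lip D0 gP c0 (conj p01 dphi).
apply: local_rhs_dist => //; rewrite (le_trans (pl _ _))//.
- by rewrite (_ : x + 1 - (y + 1) = x - y)//; ring.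
- by rewrite (_ : x - 1 - (y - 1) = x - y)//; ring.
- by rewrite (_ : x - c * tau - (y - c * tau) = x - y)//; ring.
Qed.

(** This integrated form of the equation, with a constant independent of phi, passes
    to pointwise limits; [quadratic_profile] is the way back. *)
Lemma profile_quadratic c phi : 0 < D -> regular_rate g K G -> 0 < c -> profile c phi ->
  forall x y, x <= y ->
  `|c * (phi y - phi x) - (y - x) * wave_rhs c phi x| <= Lf * (B / c) * (y - x) ^+ 2.
Proof.
move=> D0 gP c0 pP x y; rewrite le_eqVlt => /predU1P[->|xy].
  by rewrite !subrr mulr0 mul0r subrr normr0 expr0n mulr0.
have [t /andP[xt ty] e] := mean_value pP.2 xy.
rewrite e (_ : _ - _ = (y - x) * (wave_rhs c phi t - wave_rhs c phi x)); last first.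
  by field; rewrite gt_eqF.
rewrite normrM gtr0_norm ?subr_gt0// expr2 mulrCA ler_pM2l ?subr_gt0// -mulrA.
rewrite (le_trans (wave_rhs_lip D0 gP c0 pP _ _))// gtr0_norm ?subr_gt0//.
have ? := rate_G_ge0 gP; have ? := rate_K gP.
rewrite ler_wpM2l//; first lra.
by rewrite ler_wpM2l ?divr_ge0//; lra.
Qed.

Lemma quadratic_profile c phi (C : R) : 0 < D -> regular_rate g K G -> 0 < c ->
  (forall x, 0 <= phi x <= 1) ->
  (forall x y, x <= y ->
    `|c * (phi y - phi x) - (y - x) * wave_rhs c phi x| <= C * (y - x) ^+ 2) ->
  profile c phi.
Proof.
move=> D0 gP c0 p01 h; split=> // x.
have rb y : `|wave_rhs c phi y| <= B by apply: (local_rhs_le (K := K)).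
have ? := rate_G_ge0 gP; have ? := rate_K gP.
have C0 : 0 <= C.
  have /le_trans := normr_ge0 (c * (phi 1 - phi 0) - (1 - 0) * wave_rhs c phi 0).
  by move=> /(_ _ (h 0 1 (ler01))); rewrite subr0 expr1n mulr1.
pose M := (B + C) / c.
have M0 : 0 <= M by rewrite divr_ge0//; lra.
(* phi is Lipschitz at small scales, hence so is the right-hand side. *)
have lip1 y z : `|y - z| <= 1 -> `|phi y - phi z| <= M * `|y - z|.
  wlog yz : y z / z <= y.
    move=> H yz1; have [zy|/ltW zy] := leP z y; first exact: H.
    by rewrite (distrC (phi y)) (distrC y); apply: H => //; rewrite distrC.
  rewrite [`|y - z|]ger0_norm ?subr_ge0// => yz1.
  have := h z y yz; have := rb z; rewrite !ler_norml => /andP[r1 r2] /andP[h1 h2].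
  have yz0 : 0 <= y - z by lra.
  have e1 : (y - z) ^+ 2 <= y - z by rewrite expr2 ler_piMr.
  have e2 : C * (y - z) ^+ 2 <= C * (y - z) by rewrite ler_wpM2l.
  have e3 : (y - z) * wave_rhs c phi z <= (y - z) * B by rewrite ler_wpM2l.
  have e4 : (y - z) * (- B) <= (y - z) * wave_rhs c phi z by rewrite ler_wpM2l.
  have e5 : M * (y - z) = (B + C) * (y - z) / c by rewrite /M; field; rewrite gt_eqF.
  by rewrite e5 -mulNr ler_pdivlMr// ler_pdivrMr//; apply/andP; split; lra.
apply: (@is_derive_quadratic _ _ _ _ ((C + Lf * M) / c)) => t t1.
have ht : `|wave_rhs c phi (x + t) - wave_rhs c phi x| <= Lf * (M * `|t|).
  have sh y : `|phi (y + t) - phi y| <= M * `|t|.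
    by have := lip1 (y + t) y; rewrite addrAC subrr add0r; apply.
  rewrite /wave_rhs [x + t + 1]addrAC [x + t - 1]addrAC [x + t - c * tau]addrAC.
  exact: local_rhs_dist.
have tt : `|t| * `|t| = t ^+ 2 by rewrite -expr2 real_normK ?num_real.
(* For t < 0 the estimate is available with base point x + t only. *)
have key : `|c * (phi (x + t) - phi x) - t * wave_rhs c phi x| <= (C + Lf * M) * t ^+ 2.
  have [t0|t0] := lerP 0 t.
    have := h x (x + t); rewrite lerDl => /(_ t0); rewrite addrAC subrr add0r => /le_trans; apply.
    by rewrite ler_wpM2r ?sqr_ge0// lerDl mulr_ge0//; lra.
  have := h (x + t) x; rewrite gerDl => /(_ (ltW t0)) h1.
  have -> : c * (phi (x + t) - phi x) - t * wave_rhs c phi x =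
     - (c * (phi x - phi (x + t)) - (x - (x + t)) * wave_rhs c phi (x + t)) +
     t * (wave_rhs c phi (x + t) - wave_rhs c phi x) by ring.
  apply: (le_trans (ler_normD _ _)); rewrite [leRHS]mulrDl; apply: lerD.
    by rewrite normrN (le_trans h1)// opprD addNKr sqrrN.
  rewrite normrM -tt.
  have h2 : `|t| * `|wave_rhs c phi (x + t) - wave_rhs c phi x| <=
      `|t| * (Lf * (M * `|t|)).
    by rewrite ler_wpM2l.
  lra.
have -> : phi (x + t) - phi x - t * (wave_rhs c phi x / c) =
   (c * (phi (x + t) - phi x) - t * wave_rhs c phi x) / c by field; rewrite gt_eqF.
by rewrite normrM normfV (gtr0_norm c0) mulrAC ler_pM2r ?invr_gt0.
Qed.

(** Each instance of the integrated equation involves only five values of the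
    function, so closeness at finitely many points suffices. *)
Lemma cluster_profile c (f : nat -> R -> R) phi (C : R) :
  0 < D -> regular_rate g K G -> 0 < c -> (forall k x, 0 <= f k x <= 1) ->
  (forall x y, x <= y -> exists E, forall k,
    `|c * (f k y - f k x) - (y - x) * wave_rhs c (f k) x| <= C * (y - x) ^+ 2 + E / k.+1%:R) ->
  (forall (s : seq R) (e : R) (N : nat), 0 < e ->
    exists2 k, (N <= k)%N & forall x, x \in s -> `|f k x - phi x| <= e) ->
  profile c phi.
Proof.
move=> D0 gP c0 f01 fE cl.
have p01 x : 0 <= phi x <= 1.
  apply/andP; split; apply: (@le_eps _ 1) => e e0 _; have [k _ /(_ x)] := cl [:: x] e 0%N e0;
    rewrite inE eqxx => /(_ isT); have /andP[? ?] := f01 k x;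
    rewrite ler_norml => /andP[? ?]; lra.
apply: (@quadratic_profile _ _ C) => // x y xy.
have [E hE] := fE x y xy.
apply: (@le_eps _ (`|E| + 2 * c + (y - x) * Lf)) => e e0 e1.
have [k ek hk] := cl [:: x; y; x + 1; x - 1; x - c * tau] e (Num.truncn e^-1) e0.
have k1 : k.+1%:R^-1 <= e.
  rewrite -[e]invrK lef_pV2 ?posrE ?invr_gt0//.
  by rewrite (le_trans (ltW (truncnS_gt _)))// ler_nat ltnS.
have hx : `|f k x - phi x| <= e by apply: hk; rewrite !inE eqxx ?orbT.
have hy : `|f k y - phi y| <= e by apply: hk; rewrite !inE eqxx ?orbT.
have hr : `|wave_rhs c (f k) x - wave_rhs c phi x| <= Lf * e.
  by apply: local_rhs_dist => //; apply: hk; rewrite !inE eqxx ?orbT.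
have hEk : E / k.+1%:R <= `|E| * e.
  rewrite (le_trans (ler_norm _))// normrM ler_wpM2l// ger0_norm//.
have -> : c * (phi y - phi x) - (y - x) * wave_rhs c phi x =
    (c * (f k y - f k x) - (y - x) * wave_rhs c (f k) x)
    + (c * ((f k x - phi x) - (f k y - phi y)) + (y - x) * (wave_rhs c (f k) x - wave_rhs c phi x)) by ring.
have n1 : `|c * ((f k x - phi x) - (f k y - phi y))| <= c * (2 * e).
  rewrite normrM gtr0_norm// ler_pM2l// (le_trans (ler_normB _ _))//; lra.
have n2 : `|(y - x) * (wave_rhs c (f k) x - wave_rhs c phi x)| <= (y - x) * (Lf * e).
  by rewrite normrM ger0_norm ?subr_ge0// ler_wpM2l// subr_ge0.
have n3 := hE k; move: hEk n3; move: (E / _) => E' hEk n3.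
apply: (le_trans (ler_normD _ _)); apply: (le_trans (lerD n3 (ler_normD _ _))); lra.
Qed.
End Profiles.

(** * Waves with supercritical speed *)
Section Roots.
Variable R : realType.
Implicit Types (D c lam eta mu h : R).

Lemma expR_convex (s a b : R) : 0 <= s <= 1 ->
  expR ((1 - s) * a + s * b) <= (1 - s) * expR a + s * expR b.
Proof.
move=> /andP[s0 s1]; have := convex_expR (Itv01 s0 s1) b a.
by rewrite !convRE /= /unstable.onem addrC [leRHS]addrC.
Qed.

(** The dispersion relation is positive at 0 and negative at eta0, which gives the
    root lam; by convexity it is negative strictly between lam and eta0, so eta can
    be chosen as close to lam as the condition eta <= 2 lam requires. *)
Lemma dispersion_roots D (g0 : R) c (eta0 : R) : 0 < D -> 0 < g0 -> 0 < eta0 ->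
  dispersion D g0 eta0 (c * eta0) < 0 ->
  exists lam eta, [/\ 0 < lam, lam < eta, eta <= 2 * lam,
    dispersion D g0 lam (c * lam) = 0 & dispersion D g0 eta (c * eta) < 0].
Proof.
move=> D0 g00 e0 neg; pose f mu : R := dispersion D g0 mu (c * mu).
have f0 : f 0 = g0 by rewrite /f /dispersion oppr0 expR0 mulr0; ring.
have cf : continuous f.
  move=> x; rewrite /f /dispersion.
  apply: cvgB; last by apply: cvgM; [exact: cvg_cst|exact: cvg_id].
  apply: cvgD; last exact: cvg_cst.
  apply: cvgM; first exact: cvg_cst.
  apply: cvgB; last exact: cvg_cst.
  apply: cvgD; first exact: continuous_expR.
  apply: (@continuous_comp _ _ _ -%R expR); first exact: opp_continuous.
  exact: continuous_expR.
have [|lam] := @IVT R f 0 eta0 0 (ltW e0) (continuous_subspaceT cf).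
  by rewrite f0 ge_min le_max (ltW g00) /= (ltW neg) orbT.
rewrite in_itv /= => /andP[l0 le] fl.
have l1 : 0 < lam.
  by rewrite lt_neqAle l0 andbT; apply/eqP => lE; move: fl; rewrite -lE f0 => e; lra.
have l2 : lam < eta0.
  rewrite lt_neqAle le andbT; apply/eqP => lE; move: fl; rewrite lE /f => e; lra.
pose d := eta0 - lam; have d0 : 0 < d by rewrite subr_gt0.
have [s [s0 s1 sd]] : exists s : R, [/\ 0 < s, s <= 1 & s * d <= lam].
  exists (Num.min 1 (lam / d)); rewrite lt_min ltr01 ge_min lexx /= divr_gt0//; split=> //.
  by rewrite -ler_pdivlMr// ge_min lexx orbT.
exists lam, ((1 - s) * lam + s * eta0).
have eE : (1 - s) * lam + s * eta0 = lam + s * d by rewrite /d; ring.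
have sd0 : 0 < s * d by rewrite mulr_gt0.
have s01 : 0 <= s <= 1 by apply/andP; split; lra.
split=> //; [lra|lra|].
have h1 := expR_convex lam eta0 s01; have h2 := expR_convex (- lam) (- eta0) s01.
have e2 : (1 - s) * - lam + s * - eta0 = - ((1 - s) * lam + s * eta0) by ring.
rewrite e2 in h2.
have h3 : D * (expR ((1 - s) * lam + s * eta0) + expR (- ((1 - s) * lam + s * eta0)))
   <= D * ((1 - s) * expR lam + s * expR eta0 + ((1 - s) * expR (- lam) + s * expR (- eta0))).
  by rewrite ler_pM2l//; lra.
have h4 : s * dispersion D g0 eta0 (c * eta0) < 0 by rewrite nmulr_llt0.
have h5 : (1 - s) * f lam = 0 by rewrite fl mulr0.
rewrite /f /dispersion in h4 h5 *; lra.
Qed.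

Lemma one_sub_expR_bounds (s : R) : 0 < s -> s / (1 + s) <= 1 - expR (- s) <= s.
Proof.
move=> s0; apply/andP; split; last by have := expR_ge1Dx (- s); lra.
have h : expR (- s) <= (1 + s)^-1.
  by rewrite expRN lef_pV2 ?posrE ?expR_gt0// ?expR_ge1Dx; lra.
have -> : s / (1 + s) = 1 - (1 + s)^-1 by field; rewrite gt_eqF; lra.
lra.
Qed.

End Roots.

Section DiscreteFamily.
Variables (R : realType) (D tau : R) (g : R -> R -> R) (K G : R).
Implicit Types (c lam eta q h : R).

(** The factor A of the backward difference is tuned so that lam is an exact root
    of the discrete dispersion relation; it is c / h up to a relative error of
    order h.  The barriers then do not depend on the mesh. *)
Lemma discrete_family c lam eta : 0 < D -> regular_rate g K G -> 0 < c ->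
  0 < lam -> lam < eta -> eta <= 2 * lam ->
  dispersion D (g 0 0) lam (c * lam) = 0 -> dispersion D (g 0 0) eta (c * eta) < 0 ->
  exists q (N : nat), 1 <= q /\ forall (M r : nat), (N <= M)%N -> (0 < M)%N ->
    let h : R := M%:R^-1 in
    exists (A : R) (z : int -> R), [/\ 0 < A, c <= A * h, A * h <= c * (1 + lam * h),
      forall i, lower_barrier lam eta q (i%:~R * h) <= z i <= upper_barrier lam (i%:~R * h) &
      forall i, A * (z i - z (i - 1)) =
        local_rhs D g (z (i + M%:Z)) (z (i - M%:Z)) (z i) (z (i - r%:Z))].
Proof.
move=> D0 gP c0 l0 le el dl de.
have K0 := rate_K gP.
have [e [e0 eE]] : exists e : R, 0 < e /\ e = - dispersion D (g 0 0) eta (c * eta).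
  by exists (- dispersion D (g 0 0) eta (c * eta)); split=> //; lra.
have [q [q1 qe]] : exists q : R, 1 <= q /\ 4 * K <= q * e.
  exists (1 + 4 * K / e); rewrite lerDl divr_ge0; [|lra|lra]; split=> //.
  by rewrite [leRHS](_ : _ = e + 4 * K); [lra|field; rewrite gt_eqF].
exists q, (Num.truncn (2 * c * eta ^+ 2 / e)).+1; split=> // M r NM M0 /=.
have M0' : 0 < M%:R :> R by rewrite ltr0n.
have [h hE] : {h : R | h = M%:R^-1} by exists M%:R^-1.
rewrite -hE.
have h0 : 0 < h by rewrite hE invr_gt0.
have Mh : M%:R * h = 1 by rewrite hE mulfV ?gt_eqF.
have hsmall : c * eta ^+ 2 * h <= e / 2.
  have h1 : 2 * c * eta ^+ 2 / e <= M%:R.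
    by rewrite (le_trans (ltW (truncnS_gt _)))// ler_nat.
  rewrite ler_pdivrMr// in h1.
  by rewrite hE ler_pdivrMr//; lra.
have lh0 : 0 < lam * h by rewrite mulr_gt0.
have eh0 : 0 < eta * h by rewrite mulr_gt0//; lra.
have /andP[u1 u2] := one_sub_expR_bounds lh0.
have /andP[v1 v2] := one_sub_expR_bounds eh0.
have den0 : 0 < 1 - expR (- (lam * h)).
  by rewrite (lt_le_trans _ u1)// divr_gt0//; lra.
pose A := c * lam / (1 - expR (- (lam * h))).
have A0 : 0 < A by rewrite !mulr_gt0 ?invr_gt0.
have Al : A * (1 - expR (- (lam * h))) = c * lam by rewrite /A divfK ?gt_eqF.
have Ah1 : c <= A * h.
  have : A * (1 - expR (- (lam * h))) <= A * (lam * h) by rewrite ler_pM2l.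
  by rewrite Al => h1; rewrite -(ler_pM2r l0); lra.
have Ah2 : A * h <= c * (1 + lam * h).
  have : A * (lam * h / (1 + lam * h)) <= A * (1 - expR (- (lam * h))) by rewrite ler_pM2l.
  rewrite Al mulrA ler_pdivrMr; last lra.
  by move=> h1; rewrite -(ler_pM2r l0); lra.
have Aeta : c * eta - c * eta ^+ 2 * h <= A * (1 - expR (- (eta * h))).
  have h1 : A * (eta * h / (1 + eta * h)) <= A * (1 - expR (- (eta * h))) by rewrite ler_pM2l.
  apply: le_trans h1; rewrite mulrA ler_pdivlMr; last lra.
  have h2 : c * eta <= A * h * eta by rewrite ler_pM2r//; lra.
  have h3 : 0 <= c * eta * (eta * h) ^+ 2 by rewrite !mulr_ge0 ?sqr_ge0//; lra.
  lra.
have [||z zb zE] := @discrete_wave R D g K G A h lam eta q M r D0 gP A0 h0 Mh l0 le el q1.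
- by rewrite Al.
- have h1 : q * dispersion D (g 0 0) eta (A * (1 - expR (- (eta * h)))) <= q * (- (e / 2)).
    rewrite ler_pM2l; last lra.
    by rewrite /dispersion in eE *; lra.
  lra.
by exists A, z.
Qed.
End DiscreteFamily.

Lemma floor_grid (R : realType) (M x h : R) : 0 < h -> M * h = 1 ->
  (Num.floor (x * M))%:~R * h <= x < (Num.floor (x * M))%:~R * h + h.
Proof.
move=> h0 Mh.
have a1 := floor_le (x * M); rewrite -(ler_pM2r h0) -[leRHS]mulrA Mh mulr1 in a1.
have a2 := floorD1_gt (x * M).
rewrite -(ltr_pM2r h0) -[ltLHS]mulrA Mh mulr1 intrD mulrDl mul1r in a2.
by rewrite a1 a2.
Qed.

Section Discrete.
Variables (R : realType) (D tau : R) (g : R -> R -> R) (K G : R).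
Implicit Types (c lam eta q h x y e A : R) (z : int -> R) (i j : int).
Local Notation B := (2 * D + G).
Local Notation Lf := (4 * D + G + 2 * K).

Lemma int_steps (z : int -> R) (b : R) : (forall i, `|z i - z (i - 1)| <= b) ->
  forall i j, `|z i - z j| <= b * `|i - j|%:~R.
Proof.
move=> h.
have up (l : nat) i : `|z (i + l%:Z) - z i| <= b * l%:R.
  elim: l => [|l IH]; first by rewrite addr0 subrr normr0 mulr0.
  have h1 := h (i + l.+1%:Z).
  have e : i + l.+1%:Z - 1 = i + l%:Z by rewrite -addn1 PoszD addrA addrK.
  rewrite e in h1; rewrite -natr1 mulrDr mulr1.
  have -> : z (i + l.+1%:Z) - z i = (z (i + l%:Z) - z i) + (z (i + l.+1%:Z) - z (i + l%:Z)) by ring.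
  by rewrite (le_trans (ler_normD _ _))// lerD.
have up' i j : j <= i -> `|z i - z j| <= b * `|i - j|%:~R.
  move=> ji; have e : i = j + (absz (i - j))%:Z by rewrite gez0_abs ?subr_ge0//; ring.
  by rewrite {1}e (le_trans (up _ _))// -abszE.
move=> i j; case: (leP j i) => [/up'//|/ltW/up'].
by rewrite distrC [`|j - i|]distrC.
Qed.

(** The step function f that takes the value z i on [i h, i h + h[ solves the
    integrated wave equation up to an error of order h: sum the discrete
    equations between x and y, and use that their right-hand sides vary slowly
    along the lattice. *)
Lemma discrete_near_profile c lam A h (M r : nat) z :
  0 < D -> regular_rate g K G -> 0 <= tau -> 0 < c -> 0 < lam -> 0 < h -> h <= 1 ->
  M%:R * h = 1 -> 0 < A -> c <= A * h -> A * h <= c * (1 + lam * h) ->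
  r = Num.truncn (c * tau * M%:R) ->
  (forall i, 0 <= z i <= 1) ->
  (forall i, A * (z i - z (i - 1)) =
     local_rhs D g (z (i + M%:Z)) (z (i - M%:Z)) (z i) (z (i - r%:Z))) ->
  let f x := z (Num.floor (x * M%:R)) in
  let C := Lf * (B / c) in
  forall x y, x <= y ->
  `|c * (f y - f x) - (y - x) * wave_rhs D tau g c f x| <=
    C * (y - x) ^+ 2 + (C * (4 * (y - x) + 1) + c * lam + B) * h.
Proof.
move=> D0 gP t0 c0 l0 h0 h1 Mh A0 Ah1 Ah2 rE z01 zE f C x y xy.
have G0 := rate_G_ge0 gP; have K0 := rate_K gP.
pose F i := local_rhs D g (z (i + M%:Z)) (z (i - M%:Z)) (z i) (z (i - r%:Z)).
have FB i : `|F i| <= B by apply: (local_rhs_le (K := K)).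
have Ai : A^-1 <= h / c.
  by rewrite ler_pdivlMr// ler_pdivrMl// mulrC.
have step i : `|z i - z (i - 1)| <= B / c * h.
  have -> : z i - z (i - 1) = F i / A by rewrite /F -zE mulrC mulKf ?gt_eqF.
  rewrite normrM normfV (gtr0_norm A0) (@le_trans _ _ (B * A^-1))//.
    by rewrite ler_pM2r ?invr_gt0.
  by rewrite -mulrA [c^-1 * h]mulrC ler_wpM2l//; lra.
have lipz := int_steps step.
have Bc0 : 0 <= B / c * h by rewrite !mulr_ge0 ?invr_ge0//; lra.
have lipF i j : `|F i - F j| <= Lf * (B / c * h * `|i - j|%:~R).
  apply: local_rhs_dist => //; rewrite (le_trans (lipz _ _))//.
  - by rewrite (_ : i + M%:Z - (j + M%:Z) = i - j)//; ring.
  - by rewrite (_ : i - M%:Z - (j - M%:Z) = i - j)//; ring.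
  - by rewrite (_ : i - r%:Z - (j - r%:Z) = i - j)//; ring.
have C0 : 0 <= C by rewrite !mulr_ge0 ?invr_ge0//; lra.
have sumF (l : nat) i : `|A * (z (i + l%:Z) - z i) - l%:R * F i| <= C * h * l%:R ^+ 2.
  elim: l => [|l IH]; first by rewrite addr0 subrr mulr0 mul0r subrr normr0 expr0n mulr0.
  have e : i + l.+1%:Z - 1 = i + l%:Z by rewrite -addn1 PoszD addrA addrK.
  have h2 := zE (i + l.+1%:Z); rewrite e -/(F _) in h2.
  have h3 := lipF (i + l.+1%:Z) i.
  rewrite (_ : i + l.+1%:Z - i = l.+1%:Z) in h3; last ring.
  rewrite -(natr1 l).
  have {}h3 : `|F (i + l.+1%:Z) - F i| <= C * h * (l%:R + 1).
    by rewrite (le_trans h3)// /C natr1 !mulrA.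
  have -> : A * (z (i + l.+1%:Z) - z i) - (l%:R + 1) * F i =
    (A * (z (i + l%:Z) - z i) - l%:R * F i) + (A * (z (i + l.+1%:Z) - z (i + l%:Z)) - F i) by ring.
  rewrite h2 (le_trans (ler_normD _ _))// (le_trans (lerD IH h3))//.
  have : 0 <= C * h * l%:R by rewrite (mulr_ge0 (mulr_ge0 C0 (ltW h0))) ?ler0n.
  move: (C * h) (l%:R : R) => a b ab; rewrite -subr_ge0.
  by rewrite (_ : _ - _ = a * b); [|ring].
pose i := Num.floor (x * M%:R); pose j := Num.floor (y * M%:R).
have M0 : 0 < M%:R :> R by rewrite -(pmulr_lgt0 _ h0) Mh.
have ij : i <= j by rewrite le_floor// ler_pM2r.
have [l jE] : exists l : nat, j = i + l%:Z.
  by exists (absz (j - i)); rewrite gez0_abs ?subr_ge0//; ring.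
have /andP[i1 i2] := floor_grid x h0 Mh; have /andP[j1 j2] := floor_grid y h0 Mh.
rewrite -/i -/j in i1 i2 j1 j2.
have lE : l%:R * h = j%:~R * h - i%:~R * h :> R.
  by rewrite jE intrD mulrDl addrAC subrr add0r.
have lh1 : l%:R * h <= y - x + h by lra.
have lh2 : y - x - h <= l%:R * h by lra.
have lh0 : 0 <= l%:R * h by rewrite mulr_ge0// ltW.
have fx1 : f (x + 1) = z (i + M%:Z).
  rewrite /f mulrDl mul1r floorDrz ?natr_int//; congr (z (_ + _)).
  by rewrite -[M%:R]/(M%:Z%:~R) intrKfloor.
have fx2 : f (x - 1) = z (i - M%:Z).
  rewrite /f mulrBl mul1r floorDrz ?rpredN ?natr_int//; congr (z (_ + _)).
  by rewrite -[M%:R]/(M%:Z%:~R) -intrN intrKfloor.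
have ftau : `|f (x - c * tau) - z (i - r%:Z)| <= B / c * h * 2.
  rewrite /f (le_trans (lipz _ _))// ler_wpM2l//.
  have b0 : 0 <= c * tau * M%:R by rewrite !mulr_ge0// ltW.
  have /andP[r1 r2] := truncn_itv b0; rewrite -rE in r1 r2.
  have k1 := floor_le ((x - c * tau) * M%:R).
  have k2 := floorD1_gt ((x - c * tau) * M%:R).
  have k3 := floor_le (x * M%:R); have k4 := floorD1_gt (x * M%:R).
  rewrite -/i in k3 k4; move: k1 k2; set k := Num.floor _ => k1 k2.
  rewrite !intrD in k2 k4; rewrite -natr1 in r2.
  rewrite intr_norm intrB intrB -pmulrn ler_norml; apply/andP; split; lra.
have rF : `|wave_rhs D tau g c f x - F i| <= Lf * (B / c * h * 2).
  have d0 : 0 <= B / c * h * 2 by lra.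
  by apply: local_rhs_dist; rewrite // ?z01 // ?fx1 ?fx2 ?subrr ?normr0.
have s1 : `|A * h * (f y - f x) - l%:R * h * F i| <= C * (y - x + h) ^+ 2.
  have -> : A * h * (f y - f x) - l%:R * h * F i =
     h * (A * (z (i + l%:Z) - z i) - l%:R * F i) by rewrite /f -/i -/j jE; ring.
  rewrite normrM (gtr0_norm h0).
  have s2 : h * `|A * (z (i + l%:Z) - z i) - l%:R * F i| <= h * (C * h * l%:R ^+ 2).
    by rewrite ler_pM2l.
  have s3 : C * (l%:R * h) ^+ 2 <= C * (y - x + h) ^+ 2.
    by rewrite ler_wpM2l// lerXn2r ?nnegrE//; lra.
  lra.
have fxy : `|f y - f x| <= 1.
  have /andP[? ?] := z01 i; have /andP[? ?] := z01 j.
  by rewrite /f -/i -/j ler_norml; apply/andP; split; lra.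
have -> : c * (f y - f x) - (y - x) * wave_rhs D tau g c f x =
  (A * h * (f y - f x) - l%:R * h * F i) + ((c - A * h) * (f y - f x)
   + ((l%:R * h - (y - x)) * F i + (y - x) * (F i - wave_rhs D tau g c f x))) by ring.
have n1 : `|(c - A * h) * (f y - f x)| <= c * lam * h * 1.
  by rewrite normrM ler_pM// ler_norml; apply/andP; split; lra.
have n2 : `|(l%:R * h - (y - x)) * F i| <= h * B.
  by rewrite normrM ler_pM// ler_norml; apply/andP; split; lra.
have n3 : `|(y - x) * (F i - wave_rhs D tau g c f x)| <= (y - x) * (Lf * (B / c * h * 2)).
  by rewrite normrM ger0_norm ?subr_ge0// ler_wpM2l ?subr_ge0// distrC.
apply: (le_trans (ler_normD _ _)); apply: (le_trans (lerD s1 (ler_normD _ _))).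
apply: (le_trans (lerD (lexx _) (lerD n1 (ler_normD _ _)))).
have n4 : C * h ^+ 2 <= C * h by rewrite ler_wpM2l// expr2 ler_piMr// ltW.
apply: (le_trans (lerD (lexx _) (lerD (lexx _) (lerD n2 n3)))).
have -> : (y - x) * (Lf * (B / c * h * 2)) = 2 * (C * h * (y - x)) by rewrite /C; ring.
clearbody C; lra.
Qed.
End Discrete.

(** The point where the lower barrier is known to be positive uniformly in the mesh;
    the shift by 1 absorbs the rounding of x to a lattice of mesh at most 1. *)
Lemma barrier_gap (R : realType) (lam eta q : R) : 0 < lam -> lam < eta -> 1 <= q ->
  exists x : R, 0 < expR (lam * (x - 1)) - q * expR (eta * x).
Proof.
move=> l0 le q1; exists ((- lam - ln (2 * q)) / (eta - lam)).
set x := _ / _.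
have e1 : eta * x = lam * (x - 1) - ln (2 * q).
  have -> : eta * x = lam * x + x * (eta - lam) by ring.
  by rewrite {2}/x divfK ?subr_eq0 ?gt_eqF//; ring.
have q0 : 0 < 2 * q by lra.
rewrite e1 expRD expRN lnK ?posrE//.
have -> : q * (expR (lam * (x - 1)) / (2 * q)) = expR (lam * (x - 1)) / 2.
  by field; rewrite gt_eqF//; lra.
by have := expR_gt0 (lam * (x - 1)); lra.
Qed.

Section Supercritical.
Variables (R : realType) (D tau : R) (g : R -> R -> R) (K G : R).

Theorem supercritical_profile (c eta0 : R) :
  0 < D -> regular_rate g K G -> 0 <= tau -> 0 < c -> 0 < eta0 ->
  dispersion D (g 0 0) eta0 (c * eta0) < 0 ->
  exists phi lam, [/\ 0 < lam, profile D tau g c phi,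
    forall x, phi x <= expR (lam * x) & exists x, 0 < phi x].
Proof.
move=> D0 gP t0 c0 e0 neg.
have G0 := rate_G_ge0 gP; have K0 := rate_K gP.
have g00 : 0 < g 0 0.
  by rewrite (lt_le_trans (rate_01 gP))// (rate_nincr gP)// ler01.
have [lam [eta [l0 le el dl de]]] := dispersion_roots D0 g00 e0 neg.
have [q [N [q1 dw]]] := discrete_family D0 gP c0 l0 le el dl de.
pose M k := (N + k).+1.
have /choice[p pP] k : exists p : R * (int -> R), let h : R := (M k)%:R^-1 in
    [/\ 0 < p.1, c <= p.1 * h, p.1 * h <= c * (1 + lam * h),
      forall i, lower_barrier lam eta q (i%:~R * h) <= p.2 i <= upper_barrier lam (i%:~R * h) &
      forall i, p.1 * (p.2 i - p.2 (i - 1)) =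
        local_rhs D g (p.2 (i + (M k)%:Z)) (p.2 (i - (M k)%:Z)) (p.2 i)
          (p.2 (i - (Num.truncn (c * tau * (M k)%:R))%:Z))].
  have [||A [z zP]] := dw (M k) (Num.truncn (c * tau * (M k)%:R)).
  - by rewrite /M; apply: leqW; apply: leq_addr.
  - by [].
  - by exists (A, z).
pose f k (x : R) := (p k).2 (Num.floor (x * (M k)%:R)).
have M0 k : 0 < (M k)%:R :> R by rewrite ltr0n.
have h0 k : 0 < (M k)%:R^-1 :> R by rewrite invr_gt0.
have hk k : (M k)%:R^-1 <= k.+1%:R^-1 :> R.
  by rewrite lef_pV2 ?posrE// ler_nat /M ltnS leq_addl.
have h1 k : (M k)%:R^-1 <= 1 :> R.
  by rewrite invf_le1// ler1n.
have Mh k : (M k)%:R * (M k)%:R^-1 = 1 :> R by rewrite mulfV ?gt_eqF.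
have p01 k i : 0 <= (p k).2 i <= 1.
  have [_ _ _ /(_ i)/andP[b1 b2] _] := pP k.
  by rewrite (le_trans (lower_barrier_ge0 _ _ _ _) b1) (le_trans b2 (upper_barrier_le1 _ _)).
have f01 k x : 0 <= f k x <= 1 by exact: p01.
have [phi phiP] := pointwise_cluster f01.
have [x0 v0] := barrier_gap l0 le q1.
exists phi, lam; split=> //.
- apply: (@cluster_profile _ D tau g K G c f phi ((4 * D + G + 2 * K) * ((2 * D + G) / c))) => //.
  move=> x y xy; set C := _ * (_ / c).
  exists (C * (4 * (y - x) + 1) + c * lam + (2 * D + G)) => k.
  have [A0 Ah1 Ah2 _ zE] := pP k.
  apply: (le_trans (@discrete_near_profile _ D tau g K G c lam _ _ (M k) _ _
    D0 gP t0 c0 l0 (h0 k) (h1 k) (Mh k) A0 Ah1 Ah2 erefl (p01 k) zE x y xy)).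
  rewrite lerD2l ler_wpM2l//.
  have C0 : 0 <= C by rewrite !mulr_ge0 ?invr_ge0//; lra.
  have : 0 <= C * (4 * (y - x) + 1) by rewrite mulr_ge0//; lra.
  have : 0 < c * lam by rewrite mulr_gt0.
  rewrite -/C; lra.
- move=> x; apply: (@le_eps _ 1) => e e1 _.
  have [k _ /(_ x)] := phiP [:: x] e 0%N e1.
  rewrite inE eqxx => /(_ isT); rewrite ler_norml => /andP[a1 a2].
  have [_ _ _ /(_ (Num.floor (x * (M k)%:R)))/andP[_ b2] _] := pP k.
  have /andP[i1 i2] := floor_grid x (h0 k) (Mh k).
  have : f k x <= expR (lam * x).
    apply: (le_trans b2); apply: (le_trans (upper_barrier_leexp _ _)).
    by rewrite ler_expR ler_pM2l.
  lra.
exists x0; apply: (lt_le_trans v0); apply: (@le_eps _ 1) => e e1 _.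
have [k _ /(_ x0)] := phiP [:: x0] e 0%N e1.
rewrite inE eqxx => /(_ isT); rewrite ler_norml => /andP[a1 a2].
have [_ _ _ /(_ (Num.floor (x0 * (M k)%:R)))/andP[b1 _] _] := pP k.
have /andP[i1 i2] := floor_grid x0 (h0 k) (Mh k).
have b2 := le_trans (lower_barrier_ge _ _ _ _) b1.
set i := Num.floor _ in i1 i2 b2.
have b3 : expR (lam * (x0 - 1)) <= expR (lam * (i%:~R * (M k)%:R^-1)).
  by rewrite ler_expR ler_pM2l//; have := h1 k; move: (_^-1) i1 i2 => h *; lra.
have b4 : q * expR (eta * (i%:~R * (M k)%:R^-1)) <= q * expR (eta * x0).
  by rewrite ler_pM2l ?ler_expR ?ler_pM2l//; lra.
rewrite -/(f k x0) in b2; lra.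
Qed.
End Supercritical.

(** * Persistence *)
Section Persistence.
Variables (R : realType) (D tau : R) (g : R -> R -> R) (K G : R).
Implicit Types (phi : R -> R) (c x y e : R).

Lemma is_derive_affine_exp phi (dphi : R -> R) (x0 c mu s : R) :
  (forall x, is_derive x 1 phi (dphi x)) ->
  is_derive s 1 (fun s => phi (x0 + c * s) * expR (mu * s))
    (c * dphi (x0 + c * s) * expR (mu * s) + phi (x0 + c * s) * (mu * expR (mu * s))).
Proof.
move=> dP.
have d1 : is_derive s 1 (fun s : R => x0 + c * s) c.
  by apply: is_derive_eq; rewrite /GRing.scale /=; ring.
have d2 : is_derive s 1 (fun s : R => mu * s) mu.
  by apply: is_derive_eq; rewrite /GRing.scale /=; ring.
have d3 : is_derive s 1 (phi \o (fun s : R => x0 + c * s)) (dphi (x0 + c * s) * c).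
  exact: is_derive1_comp.
have d4 : is_derive s 1 (expR \o (fun s : R => mu * s)) (expR (mu * s) * mu).
  exact: is_derive1_comp.
rewrite (_ : (fun s => _) = (phi \o (fun s : R => x0 + c * s)) *
  (expR \o (fun s : R => mu * s)))//.
have d5 := is_deriveM d3 d4; apply: is_derive_eq.
rewrite /GRing.scale /=; ring.
Qed.

(** phi loses mass at rate at most (2 D + G) / c, so phi e^{kap x} is monotone. *)
Lemma profile_decay c phi : 0 < D -> regular_rate g K G -> 0 < c -> profile D tau g c phi ->
  forall x s, 0 <= s -> phi x * expR (- ((2 * D + G) / c * s)) <= phi (x + s).
Proof.
move=> D0 gP c0 [p01 dphi] x s; rewrite le_eqVlt => /predU1P[<-|s0].
  by rewrite mulr0 oppr0 expR0 mulr1 addr0.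
set kap := _ / c.
have dv := fun t => is_derive_affine_exp x 1 kap t dphi.
have [t /andP[t0 ts]] := mean_value dv s0.
rewrite !mulr0 addr0 expR0 mulr1 !mul1r subr0.
set y := x + t => e.
have h : 0 <= wave_rhs D tau g c phi y / c * expR (kap * t) + phi y * (kap * expR (kap * t)).
  have -> : wave_rhs D tau g c phi y / c * expR (kap * t) + phi y * (kap * expR (kap * t)) =
    (wave_rhs D tau g c phi y + (2 * D + G) * phi y) / c * expR (kap * t) by rewrite /kap; ring.
  rewrite !mulr_ge0 ?expR_ge0 ?invr_ge0 ?(ltW c0)//.
  have /andP[a1 a2] := p01 (y + 1); have /andP[b1 b2] := p01 (y - 1).
  have /andP[m1 m2] := p01 y.
  have := rate_bound gP (p01 y) (p01 (y - c * tau)); rewrite ler_norml => /andP[g1 _].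
  have h1 : 0 <= D * (phi (y + 1) + phi (y - 1)) by rewrite mulr_ge0//; lra.
  have h2 : 0 <= phi y * (G + g (phi y) (phi (y - c * tau))) by rewrite mulr_ge0//; lra.
  rewrite /wave_rhs /local_rhs; lra.
have h1 : phi x <= phi (x + s) * expR (kap * s).
  by rewrite -subr_ge0 e mulr_ge0// ltW.
by rewrite expRN ler_pdivrMr ?expR_gt0.
Qed.

(** In lattice coordinates u_n(s) = phi (x0 + n + c s), consider the minimum of
    u_n(s) e^{- mu s} / eta(n) over the window 0 <= n <= P and the times s in
    [0, t], where eta(n) = (n + 1) (P + 1 - n) vanishes next to the window and has
    second difference -2.  At a minimum with s > 0 the time derivative is at most 0
    and the neighbours of u_n are at least their share of the profile eta; since
    diffusion out of the window costs at most gam / 2, where gam = g(0,1), this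
    forces u_n >= d1.  At a minimum with s = 0 the lower bound e on phi x0 gives
    exponential growth.  In both cases u_0(t) >= d1 / (P + 1)^2 for t large.

    The delayed value enters only through g(u,v) >= g(u,1). *)
Theorem persistence : 0 < D -> regular_rate g K G ->
  exists2 delta : R, 0 < delta & forall c phi, 0 < c -> profile D tau g c phi ->
    forall e : R, 0 < e -> exists T : R, forall x0, e <= phi x0 ->
      forall x, x0 + T <= x -> delta <= phi x.
Proof.
move=> D0 gP; have K0 := rate_K gP; have G0 := rate_G_ge0 gP.
have [gam [gam0 gamE]] : exists gam : R, 0 < gam /\ gam = g 0 1.
  by exists (g 0 1); split=> //; exact: rate_01 gP.
pose P := Num.truncn (4 * D / gam).
have [N [N1 NE NP]] : exists N : R, [/\ 1 <= N, N = P.+1%:R & 4 * D <= gam * N].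
  exists P.+1%:R; split=> //; first by rewrite ler1n.
  by rewrite -ler_pdivrMl// mulrC ltW// truncnS_gt.
pose eta (x : R) : R := (x + 1) * (N - x).
pose mu := gam / 4; have mu0 : 0 < mu by rewrite divr_gt0.
have [d1 [d10 d1E]] : exists d1 : R, 0 < d1 /\ 8 * K * d1 = gam.
  exists (gam / (8 * K)); rewrite divr_gt0 ?mulr_gt0//; split=> //.
  by field; rewrite gt_eqF.
have etaP (n : 'I_P.+1) : N <= eta n%:R <= N ^+ 2.
  have n0 : 0 <= n%:R :> R by [].
  have n1 : n%:R <= N - 1 :> R by rewrite NE -natr1 addrK ler_nat -ltnS.
  have h1 : 0 <= n%:R * (N - 1 - n%:R) by rewrite mulr_ge0//; lra.
  have h2 : 0 <= n%:R * n%:R :> R by rewrite mulr_ge0.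
  have h3 : 0 <= (N - 1 - n%:R) * N by rewrite mulr_ge0//; lra.
  by rewrite /eta; apply/andP; split; nra.
have NN : 0 < N ^+ 2 by rewrite exprn_gt0//; lra.
exists (d1 / N ^+ 2); first by rewrite divr_gt0.
move=> c phi c0 pP e e0; have [p01 dphi] := pP.
pose kap := (2 * D + G) / c.
pose t1 := d1 / (e * expR (- (kap * N))) / mu.
have ee0 : 0 < e * expR (- (kap * N)) by rewrite mulr_gt0 ?expR_gt0.
exists (c * t1) => x0 ex0 x x0x.
pose t := (x - x0) / c.
have t1t : t1 <= t by rewrite ler_pdivlMr// mulrC; lra.
have t10 : 0 <= t1 by rewrite !mulr_ge0 ?invr_ge0 ?ltW.
have t0 : 0 <= t by lra.
have xE : x = x0 + 0%:R + c * t by rewrite addr0 /t mulrCA mulfV ?gt_eqF// mulr1; ring.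
pose v (n : 'I_P.+1) (s : R) : R := phi (x0 + n%:R + c * s) * expR (- mu * s).
have dv n s := is_derive_affine_exp (x0 + n%:R) c (- mu) s dphi.
have /choice[sm smP] (n : 'I_P.+1) : exists s : R, [/\ 0 <= s, s <= t &
    forall r, 0 <= r <= t -> v n s <= v n r].
  have [s] := EVT_min t0 (continuous_subspaceT (is_derive_continuous (dv n))).
  by rewrite in_itv /= => /andP[s0 st] h; exists s; split=> // r rP; exact: h.
pose w n := v n (sm n) / eta n%:R.
pose n := [arg min_(i < (ord0 : 'I_P.+1)) w i]%O.
have wn m : w n <= w m by rewrite /n; case: arg_minP => // i _; exact.
have [s0 st smin] := smP n; have /andP[en1 en2] := etaP n.
have en0 : 0 < eta n%:R by lra.
pose y := x0 + n%:R + c * sm n.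
have py0 : 0 < phi y.
  have : phi x0 * expR (- (kap * (n%:R + c * sm n))) <= phi (x0 + (n%:R + c * sm n)).
    by apply: (profile_decay D0 gP c0 pP); rewrite addr_ge0// mulr_ge0// ltW.
  by rewrite addrA; apply: lt_le_trans; rewrite mulr_gt0 ?expR_gt0//; lra.
have main : w n * expR (mu * t) <= phi x.
  have h1 : w n <= v ord0 t.
    rewrite (le_trans (wn ord0))// /w.
    have [_ _ /(_ t)] := smP ord0; rewrite t0 lexx => /(_ isT) h.
    have /andP[eo _] := etaP ord0.
    rewrite ler_pdivrMr; last lra.
    have v0 : 0 <= v ord0 t by rewrite mulr_ge0 ?expR_ge0//; case/andP: (p01 (x0 + (@ord0 P)%:R + c * t)).
    by rewrite (le_trans h)// ler_peMr//; lra.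
  have -> : phi x = v ord0 t * expR (mu * t).
    by rewrite /v -mulrA -expRD mulNr addNr expR0 mulr1 {1}xE.
  by rewrite ler_pM2r ?expR_gt0.
apply: le_trans main.
move: s0; rewrite le_eqVlt => /predU1P[s0|s0].
  (* The minimum is attained at the initial time. *)
  have h1 : e * expR (- (kap * N)) <= v n (sm n).
    rewrite /v -s0 !mulr0 addr0 expR0 mulr1.
    have h2 : phi x0 * expR (- (kap * n%:R)) <= phi (x0 + n%:R).
      exact: (profile_decay D0 gP c0 pP).
    apply: le_trans h2; rewrite ler_pM ?expR_ge0//; first exact: ltW.
    have kap0 : 0 <= kap by rewrite divr_ge0//; lra.
    by rewrite ler_expR lerN2 ler_wpM2l// NE ler_nat ltnW.
  have h3 : mu * t1 <= expR (mu * t).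
    have := expR_ge1Dx (mu * t); have : mu * t1 <= mu * t by rewrite ler_pM2l.
    lra.
  have h4 : d1 = e * expR (- (kap * N)) * (mu * t1).
    by rewrite /t1; field; rewrite !gt_eqF// expR_gt0.
  rewrite /w mulrAC ler_pM ?invr_ge0//; [exact: ltW|exact: ltW| |].
    by rewrite h4; apply: ler_pM => //; [exact: ltW|rewrite mulr_ge0// ltW].
  by rewrite lef_pV2 ?posrE//.
(* The minimum is attained at a positive time. *)
have yd1 : d1 <= phi y.
  have dle : c * (wave_rhs D tau g c phi y / c) * expR (- mu * sm n) +
      phi y * (- mu * expR (- mu * sm n)) <= 0.
    apply: (derive_le0_at_left_min (dv n (sm n)) s0) => r /andP[r0 rs].
    by apply: smin; rewrite r0 (le_trans rs).
  have rle : wave_rhs D tau g c phi y <= mu * phi y.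
    have E0 := expR_gt0 (- mu * sm n).
    rewrite -subr_le0 -(pmulr_lle0 _ E0).
    by apply: le_trans dle; rewrite le_eqVlt; apply/orP; left; apply/eqP; field; rewrite gt_eqF.
  (* Neighbours outside of the window are covered by eta z = 0. *)
  have nb (z : R) : (exists m : 'I_P.+1, z = m%:R) \/ eta z = 0 ->
      eta z * phi y <= eta n%:R * phi (x0 + z + c * sm n).
    move=> [[m ->]|->]; last first.
      by rewrite mul0r mulr_ge0 ?(ltW en0)//; case/andP: (p01 (x0 + z + c * sm n)).
    have [_ _ /(_ (sm n))] := smP m; rewrite (ltW s0) st => /(_ isT) h.
    have /andP[em _] := etaP m; have em0 : 0 < eta m%:R by lra.
    have : w n <= v m (sm n) / eta m%:R.
      by rewrite (le_trans (wn m))// /w ler_pM2r// invr_gt0.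
    rewrite /w ler_pdivrMr// mulrAC ler_pdivlMr// /v -/y.
    rewrite ![_ * expR _ * _]mulrAC ler_pM2r ?expR_gt0//.
    by rewrite mulrC [leRHS]mulrC.
  have nbp : eta (n%:R + 1) * phi y <= eta n%:R * phi (y + 1).
    have -> : y + 1 = x0 + (n%:R + 1) + c * sm n by rewrite /y; ring.
    apply: nb; have := ltn_ord n; rewrite leq_eqVlt => /predU1P[nP|nP].
      have e1 : n.+1%:R = N by rewrite nP NE.
      by right; rewrite /eta natr1 e1 subrr mulr0.
    by left; exists (Ordinal nP); rewrite natr1.
  have nbm : eta (n%:R - 1) * phi y <= eta n%:R * phi (y - 1).
    have -> : y - 1 = x0 + (n%:R - 1) + c * sm n by rewrite /y; ring.
    apply: nb; case: (posnP n) => [->|n0].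
      by right; rewrite /eta sub0r addNr mul0r.
    have nP : (n.-1 < P.+1)%N by rewrite (leq_ltn_trans (leq_pred _)).
    by left; exists (Ordinal nP) => /=; rewrite -[in LHS](prednK n0) -natr1 addrK.
  have sec : eta (n%:R + 1) + eta (n%:R - 1) = 2 * eta n%:R - 2 by rewrite /eta; ring.
  have /andP[py1 py2] := p01 y.
  have h01 : 0 <= (0 : R) <= 1 by rewrite lexx ler01.
  have h11 : 0 <= (1 : R) <= 1 by rewrite lexx ler01.
  have /andP[q1 q2] := p01 (y - c * tau).
  have gl : gam - 2 * K * phi y <= g (phi y) (phi (y - c * tau)).
    by rewrite gamE; apply: (rate_ge_approx gP) => //; lra.
  have h1 : eta n%:R * (D * (phi (y + 1) + phi (y - 1) - 2 * phi y)) >= - (2 * D) * phi y.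
    have : D * ((eta (n%:R + 1) + eta (n%:R - 1)) * phi y) <=
        D * (eta n%:R * (phi (y + 1) + phi (y - 1))).
      by rewrite ler_pM2l//; lra.
    rewrite sec; lra.
  have h2 : phi y * (gam - 2 * K * phi y) <= phi y * g (phi y) (phi (y - c * tau)).
    by rewrite ler_pM2l.
  have h3 : - (2 * D) * phi y + eta n%:R * (phi y * (gam - 2 * K * phi y)) <= eta n%:R * (mu * phi y).
    have : eta n%:R * wave_rhs D tau g c phi y <= eta n%:R * (mu * phi y) by rewrite ler_pM2l.
    have : eta n%:R * (phi y * (gam - 2 * K * phi y)) <=
       eta n%:R * (phi y * g (phi y) (phi (y - c * tau))) by rewrite ler_pM2l.
    rewrite /wave_rhs /local_rhs; lra.
  have h4 : - (2 * D) + eta n%:R * (gam - 2 * K * phi y) <= eta n%:R * mu.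
    by rewrite -(ler_pM2r py0); lra.
  have h5 : 4 * D <= gam * eta n%:R by rewrite (le_trans NP)// ler_pM2l.
  have h6 : gam / 2 - 2 * K * phi y <= mu by rewrite -(ler_pM2l en0); lra.
  by rewrite -(ler_pM2l K0); rewrite /mu in h6; lra.
have h1 : d1 * expR (- (mu * t)) <= v n (sm n).
  rewrite /v -/y ler_pM ?expR_ge0//; first exact: ltW.
  by rewrite ler_expR mulNr lerN2 ler_pM2l.
have h2 : d1 <= v n (sm n) * expR (mu * t).
  by rewrite -ler_pdivrMr ?expR_gt0// -expRN.
rewrite /w mulrAC ler_pM ?invr_ge0//; [exact: ltW|exact: ltW|].
by rewrite lef_pV2 ?posrE.
Qed.
End Persistence.

(** * Waves with speed at least c* *)

(** x is the supremum of the points to the left of which f is at most d. *)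
Lemma first_crossing (R : realType) (f : R -> R) (L d a b : R) :
  0 < L -> (forall x y, `|f x - f y| <= L * `|x - y|) ->
  (forall y, y <= a -> f y <= d) -> d < f b ->
  exists2 x, f x = d & forall y, y <= x -> f y <= d.
Proof.
move=> L0 fL fa fb.
pose S : set R := [set x | forall y, y <= x -> f y <= d].
have Sub : ubound S b.
  by move=> x Sx; rewrite leNgt; apply/negP => bx; have := Sx b (ltW bx); rewrite leNgt fb.
have supS : has_sup S by split; [exists a|exists b].
pose x := sup S.
have below y : y < x -> f y <= d.
  move=> yx; have [s Ss ys] : exists2 s, S s & y < s.
    have xy0 : 0 < x - y by rewrite subr_gt0.
    by have [s Ss] := sup_adherent xy0 supS; rewrite subKr; exists s.
  by apply: Ss; exact: ltW.
have fx : f x <= d.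
  apply: (@le_eps _ L) => e e0 _.
  have h1 : f (x - e) <= d by apply: below; lra.
  have := fL x (x - e); rewrite (_ : x - (x - e) = e); last ring.
  by rewrite (gtr0_norm e0) ler_norml => /andP[_ ?]; lra.
have le_x y : y <= x -> f y <= d by rewrite le_eqVlt => /predU1P[->//|/below].
exists x => //; apply/eqP; rewrite eq_le fx /= leNgt; apply/negP => fxd.
pose r := (d - f x) / L; have r0 : 0 < r by rewrite divr_gt0// subr_gt0.
have : S (x + r).
  move=> y yxr; have [/le_x//|xy] := leP y x.
  have := fL y x; rewrite ler_norml gtr0_norm ?subr_gt0// => /andP[_ h1].
  have : L * (y - x) <= L * r by rewrite ler_pM2l//; lra.
  by rewrite /r mulrC [L * _]mulrC divfK ?gt_eqF//; lra.
by move/(ub_le_sup supS.2); rewrite -/x; lra.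
Qed.

Section Existence.
Variables (R : realType) (D tau : R) (g : R -> R -> R) (K G : R).
Implicit Types (phi : R -> R) (c x y e : R).

Lemma wave_rhs_shift c phi (a x : R) :
  wave_rhs D tau g c (fun x => phi (x + a)) x = wave_rhs D tau g c phi (x + a).
Proof. by rewrite /wave_rhs !(addrAC x _ a). Qed.

(** A zero is a minimum, so the derivative is not positive there, and the equation
    forces the neighbours to vanish as well. *)
Lemma profile_zero c phi x : 0 < D -> 0 < c -> profile D tau g c phi ->
  phi x = 0 -> forall n : nat, phi (x + n%:R) = 0.
Proof.
move=> D0 c0 [p01 dp] px; elim=> [|n IH]; first by rewrite addr0.
rewrite -natr1 addrA; move: (x + n%:R) IH => {px}x px.
have p0 y : 0 <= phi y by case/andP: (p01 y).
have : wave_rhs D tau g c phi x / c <= 0.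
  apply: (derive_le0_at_left_min (a := x - 1) (dp x)); first lra.
  by move=> s _; rewrite px.
rewrite pmulr_lle0 ?invr_gt0// /wave_rhs /local_rhs px mulr0 subr0 mul0r addr0.
rewrite pmulr_rle0// => h; have := p0 (x + 1); have := p0 (x - 1) => ? ?.
by apply/eqP; rewrite eq_le; apply/andP; split; lra.
Qed.

(** The limit of translated waves with speeds [ck k], which decrease to c. *)
Theorem profile_exists c : 0 < D -> regular_rate g K G -> 0 <= tau -> 0 < c ->
  (forall c', c < c' -> exists2 eta : R, 0 < eta & dispersion D (g 0 0) eta (c' * eta) < 0) ->
  exists phi, [/\ profile D tau g c phi, forall x, 0 < phi x,
    forall e, 0 < e -> exists X : R, forall x, x <= X -> phi x <= e &
    exists delta X : R, 0 < delta /\ forall x, X <= x -> delta <= phi x].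
Proof.
move=> D0 gP t0 c0 crit; have K0 := rate_K gP; have G0 := rate_G_ge0 gP.
have [delta dl0 pers] := @persistence R D tau g K G D0 gP.
pose d := delta / 2; have d0 : 0 < d by rewrite divr_gt0.
have ddl : d < delta by rewrite /d; lra.
pose ck (k : nat) : R := c + k.+1%:R^-1.
have ik0 (k : nat) : 0 < k.+1%:R^-1 :> R by rewrite invr_gt0.
have cck k : c < ck k by rewrite /ck ltrDl.
have ck0 k : 0 < ck k by rewrite (lt_trans c0).
have /choice[p pP] k : exists p : (R -> R) * R, [/\ profile D tau g (ck k) p.1, p.1 p.2 = d &
    forall x, x <= p.2 -> p.1 x <= d].
  have [eta e0 neg] := crit _ (cck k).
  have [phi [lam [l0 pP pe [x px]]]] := supercritical_profile D0 gP t0 (ck0 k) e0 neg.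
  have [T hT] := pers _ _ (ck0 k) pP _ px.
  have pb : d < phi (x + T) by exact: (lt_le_trans ddl (hT x (lexx _) _ (lexx _))).
  have L0 : 0 < (2 * D + G) / ck k by rewrite divr_gt0//; lra.
  have [|z zd zle] := first_crossing (a := ln d / lam) L0 (profile_lip D0 gP (ck0 k) pP) _ pb.
    move=> y yle; rewrite (le_trans (pe y))// -[leRHS]lnK ?posrE// ler_expR.
    by rewrite mulrC -ler_pdivlMr.
  by exists (phi, z).
pose f k (x : R) := (p k).1 (x + (p k).2).
have f01 k x : 0 <= f k x <= 1 by have [[p01 _] _ _] := pP k; exact: p01.
have [phi phiP] := pointwise_cluster f01.
have phP : profile D tau g c phi.
  apply: (@cluster_profile _ D tau g K G c f phi ((4 * D + G + 2 * K) * ((2 * D + G) / c))) => //.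
  move=> x y xy; exists (1 + (y - x) * ((4 * D + G + 2 * K) * ((2 * D + G) / c * tau))) => k.
  have [fP _ _] := pP k.
  have := profile_quadratic D0 gP (ck0 k) fP (x := x + (p k).2) (y := y + (p k).2).
  rewrite lerD2r => /(_ xy); rewrite -wave_rhs_shift -/(f k) -/(f k y) -/(f k x).
  have -> : y + (p k).2 - (x + (p k).2) = y - x by ring.
  move=> q1.
  have [M [M0 ME ckM]] : exists M : R, [/\ 0 <= M, M = (2 * D + G) / c & (2 * D + G) / ck k <= M].
    exists ((2 * D + G) / c); split=> //; first by rewrite divr_ge0//; lra.
    by rewrite ler_wpM2l ?lef_pV2 ?posrE ?ltW//; lra.
  have q2 : (4 * D + G + 2 * K) * ((2 * D + G) / ck k) * (y - x) ^+ 2 <=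
      (4 * D + G + 2 * K) * M * (y - x) ^+ 2.
    by rewrite ler_wpM2r ?sqr_ge0// ler_wpM2l//; lra.
  have q3 : `|wave_rhs D tau g (ck k) (f k) x - wave_rhs D tau g c (f k) x| <=
      (4 * D + G + 2 * K) * (M * (tau * k.+1%:R^-1)).
    have b0 : 0 <= M * (tau * k.+1%:R^-1) by rewrite !mulr_ge0// ltW.
    apply: local_rhs_dist; rewrite // ?subrr ?normr0 //.
    rewrite (le_trans (profile_lip D0 gP (ck0 k) fP _ _))//.
    have -> : x - ck k * tau + (p k).2 - (x - c * tau + (p k).2) = - (tau * k.+1%:R^-1).
      by rewrite /ck; ring.
    by rewrite normrN ger0_norm ?mulr_ge0 ?(ltW (ik0 k))// ler_wpM2r// mulr_ge0// ltW.
  have q4 : `|f k y - f k x| <= 1.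
    have /andP[? ?] := f01 k x; have /andP[? ?] := f01 k y.
    by rewrite ler_norml; apply/andP; split; lra.
  rewrite -ME.
  have -> : c * (f k y - f k x) - (y - x) * wave_rhs D tau g c (f k) x =
     (ck k * (f k y - f k x) - (y - x) * wave_rhs D tau g (ck k) (f k) x) +
     ((y - x) * (wave_rhs D tau g (ck k) (f k) x - wave_rhs D tau g c (f k) x)
      - k.+1%:R^-1 * (f k y - f k x)) by rewrite /ck; ring.
  have q5 : `|(y - x) * (wave_rhs D tau g (ck k) (f k) x - wave_rhs D tau g c (f k) x)| <=
     (y - x) * ((4 * D + G + 2 * K) * (M * (tau * k.+1%:R^-1))).
    by rewrite normrM ger0_norm ?subr_ge0// ler_wpM2l ?subr_ge0.
  have q6 : `|k.+1%:R^-1 * (f k y - f k x)| <= k.+1%:R^-1 * 1.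
    by rewrite normrM (gtr0_norm (ik0 k)) ler_pM2l.
  apply: (le_trans (ler_normD _ _)).
  apply: (le_trans (lerD (le_trans q1 q2) (ler_normB _ _))).
  apply: (le_trans (lerD (lexx _) (lerD q5 q6))).
  by move: (k.+1%:R^-1) => i; lra.
have ph0 : phi 0 = d.
  apply/eqP; rewrite -subr_eq0 -normr_le0; apply: (@le_eps _ 1) => e e0 _.
  have [k _ /(_ 0)] := phiP [:: 0] e 0%N e0; rewrite inE eqxx => /(_ isT).
  by have [_ pd _] := pP k; rewrite /f add0r pd distrC add0r mul1r.
have phle x : x <= 0 -> phi x <= d.
  move=> x0; apply: (@le_eps _ 1) => e e0 _.
  have [k _ /(_ x)] := phiP [:: x] e 0%N e0; rewrite inE eqxx => /(_ isT).
  have [_ _ /(_ (x + (p k).2))] := pP k; rewrite gerDr => /(_ x0).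
  by rewrite -/(f k x) ler_norml => ? /andP[? ?]; lra.
(* The level d < delta at 0 excludes large values far to the left and yields
   values above delta far to the right. *)
have persp := pers _ _ c0 phP.
have [T hT] : exists T : R, forall x, T <= x -> delta <= phi x.
  have [T hT] := persp _ d0; exists T => x Tx; apply: (hT 0); rewrite ?ph0//; lra.
exists phi; split=> //.
- move=> x; rewrite lt_neqAle; case/andP: (phP.1 x) => -> _; rewrite andbT.
  apply/eqP => px; have := profile_zero D0 c0 phP (esym px) (Num.truncn `|T - x|).+1.
  have h1 := truncnS_gt `|T - x|; have h2 := ler_norm (T - x).
  move=> z; have := hT (x + (Num.truncn `|T - x|).+1%:R); rewrite z; lra.
- move=> e e0; have [T' hT'] := persp _ e0; exists (- T') => x xT.
  rewrite leNgt; apply/negP => /ltW px.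
  have := hT' x px 0; rewrite ph0; lra.
- by exists delta, T.
Qed.
End Existence.

(** * No waves with subcritical speed *)
Section Nonexistence.
Variables (R : realType) (D tau : R) (g : R -> R -> R) (K G : R).
Implicit Types (phi : R -> R) (c x y e : R).

Lemma is_derive_shift phi (dphi : R -> R) (x0 s : R) :
  (forall x, is_derive x 1 phi (dphi x)) ->
  is_derive s 1 (fun s => phi (x0 + s)) (dphi (x0 + s)).
Proof.
move=> dP.
have d1 : is_derive s 1 (fun s : R => x0 + s) 1.
  by apply: is_derive_eq; rewrite /GRing.scale /=; ring.
have d2 : is_derive s 1 (phi \o (fun s : R => x0 + s)) (dphi (x0 + s) * 1).
  exact: is_derive1_comp.
by rewrite mulr1 in d2.
Qed.

(** The derivative of the dispersion relation vanishes at a; e^a solves a quadratic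
    equation. *)
Lemma balanced_exponent c : 0 < D -> 0 < c ->
  exists a : R, 0 < a /\ D * (expR a - expR (- a)) = c.
Proof.
move=> D0 c0; pose X := c / D; have X0 : 0 < X by rewrite divr_gt0.
have S0 : 0 <= X ^+ 2 + 4 by rewrite addr_ge0// sqr_ge0.
pose s := Num.sqrt (X ^+ 2 + 4).
have sE : s ^+ 2 = X ^+ 2 + 4 by rewrite sqr_sqrtr.
have s0 : 0 <= s by exact: sqrtr_ge0.
have X2 : 0 < X ^+ 2 by rewrite exprn_gt0.
have s2 : 2 < s by rewrite -(ltr_pXn2r (ltn0Sn 1)) ?nnegrE// sE; lra.
pose x := (X + s) / 2; have x1 : 1 < x by rewrite /x; lra.
have x0 : 0 < x by lra.
exists (ln x); rewrite ln_gt0//; split=> //.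
rewrite expRN lnK ?posrE//.
have e1 : x ^+ 2 - 1 = X * x.
  have -> : x ^+ 2 = (X ^+ 2 + 2 * X * s + s ^+ 2) / 4 by rewrite /x; field.
  by rewrite sE /x; field.
have -> : x - x^-1 = (x ^+ 2 - 1) / x by field; rewrite gt_eqF.
by rewrite e1 mulfK ?gt_eqF// /X mulrCA mulfV ?gt_eqF// mulr1.
Qed.

(** With centre y0, the function e^{a s} max(0, r^2 - s^2) is the subsolution, and
    [touch] says that k phi is the least multiple of phi above it; they meet at
    s0.  Write b = r^2 - s0^2.  Because D (e^a - e^{-a}) = c, the terms linear in s0
    cancel when both neighbours are bounded below by the parabola, and what
    remains is b sg / 2 - D (p + m), which is positive for b >= b0.  For b < b0 the point s0 is
    near an end of the support, and the neighbour on the inner side alone gives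
    the contradiction. *)
Theorem no_subcritical_profile c phi : 0 < D -> regular_rate g K G -> 0 <= tau -> 0 < c ->
  (forall mu : R, 0 < mu -> 0 < dispersion D (g 0 0) mu (c * mu)) ->
  (forall x, is_derive x 1 phi (wave_rhs D tau g c phi x / c)) ->
  (forall x, 0 < phi x) ->
  (forall e, 0 < e -> exists X : R, forall x, x <= X -> phi x <= e) -> False.
Proof.
move=> D0 gP t0 c0 disp dphi pp plim.
have K0 := rate_K gP; have G0 := rate_G_ge0 gP.
have [a [a0 aE]] := balanced_exponent D0 c0.
have [sg [sg0 sgE]] : exists sg : R, 0 < sg /\ sg = dispersion D (g 0 0) a (c * a).
  by exists (dispersion D (g 0 0) a (c * a)); split=> //; exact: disp.
have [p [m [p0 m0 pE mE]]] : exists p m : R, [/\ 0 < p, 0 < m, p = expR a & m = expR (- a)].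
  by exists (expR a), (expR (- a)); rewrite !expR_gt0.
rewrite -pE -mE in aE; rewrite /dispersion -pE -mE in sgE.
(* To the left of X, phi is so small that the growth rate is almost g 0 0. *)
have [th [th0 th1 thK]] : exists th : R, [/\ 0 < th, th <= 1 & 2 * K * th <= sg / 2].
  exists (Num.min 1 (sg / 2 / (2 * K))); rewrite lt_min ltr01 ge_min lexx /=.
  rewrite !divr_gt0 ?mulr_gt0//; split=> //.
  by rewrite mulrC -ler_pdivlMr ?mulr_gt0// ge_min lexx orbT.
have [X hX] := plim _ th0.
have rate x : x <= X -> g 0 0 - sg / 2 <= g (phi x) (phi (x - c * tau)).
  move=> xX; have ct : 0 <= c * tau by rewrite mulr_ge0// ltW.
  have xX' : x - c * tau <= X by lra.
  have p1 := pp x; have p2 := pp (x - c * tau); have q1 := hX _ xX; have q2 := hX _ xX'.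
  have h00 : 0 <= (0 : R) <= 1 by rewrite lexx ler01.
  have r1 : 0 <= phi x <= 1 by apply/andP; split; lra.
  have r2 : 0 <= phi (x - c * tau) <= 1 by apply/andP; split; lra.
  have := rate_ge_approx gP r1 r2 h00 h00 (ltW th0); rewrite !add0r => /(_ q1 q2); lra.
have [b0 [b01 b0E]] : exists b0 : R, 1 <= b0 /\ D * (p + m) < b0 * (sg / 2).
  have Dpm : 0 < D * (p + m) by rewrite mulr_gt0//; lra.
  have s2 : 0 < sg / 2 by lra.
  exists (1 + (D * (p + m)) / (sg / 2)); split; first by rewrite lerDl divr_ge0// ltW.
  by rewrite mulrDl divfK ?gt_eqF//; lra.
pose W := c * a + 2 * D + sg.
have W0 : 0 < W by rewrite /W; have : 0 < c * a by [rewrite mulr_gt0]; lra.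
have [rho [rho0 rho1 rho2]] : exists rho : R, [/\ 0 < rho, D * m + b0 * W < 2 * c * rho &
    D * p + b0 * W < 2 * D * m * rho].
  have bW : 0 < b0 * W by rewrite mulr_gt0//; lra.
  have Dp : 0 < D * p by rewrite mulr_gt0.
  have Dm : 0 < D * m by rewrite mulr_gt0.
  have solve (x y : R) : 0 < x -> 0 < y -> exists z : R, 0 < z /\ x * z = y.
    by move=> x0 y0; exists (y / x); rewrite divr_gt0// mulrC divfK ?gt_eqF.
  have [||r1 [r10 e1]] := solve (2 * c) (D * m + b0 * W); [by rewrite mulr_gt0|lra|].
  have [||r2 [r20 e2]] := solve (2 * D * m) (D * p + b0 * W); [by rewrite !mulr_gt0|lra|].
  have h1 : 0 < 2 * c * r2 by rewrite !mulr_gt0.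
  have h2 : 0 < 2 * D * m * r1 by rewrite !mulr_gt0.
  by exists (r1 + r2); split; lra.
pose r := rho + b0; have r0 : 0 < r by rewrite /r; lra.
have rr : rho ^+ 2 + b0 <= r ^+ 2.
  have : 0 <= rho * b0 by rewrite mulr_ge0//; lra.
  have : 0 <= b0 * (b0 - 1) by rewrite mulr_ge0//; lra.
  by rewrite /r; lra.
pose y0 := X - r.
pose bump (s : R) := r ^+ 2 - s ^+ 2.
have dbump (s : R) : is_derive s 1 bump (- 2 * s).
  by apply: is_derive_eq; rewrite /GRing.scale /= ?sub0r; ring.
pose num (s : R) := bump (0 + 1 * s) * expR (a * s).
pose den (s : R) := phi (y0 + s).
have dnum (s : R) := is_derive_affine_exp 0 1 a s dbump.
have dden (s : R) := is_derive_shift y0 s dphi.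
have cq : continuous (fun s => num s / den s).
  move=> s; apply: cvgM; first exact: (is_derive_continuous dnum).
  by apply: cvgV; [rewrite gt_eqF// pp|exact: (is_derive_continuous dden)].
have rNr : - r <= r by lra.
have [s0] := EVT_max rNr (continuous_subspaceT cq).
rewrite in_itv /= => /andP[s01 s02] smax.
have numE s : num s = (r ^+ 2 - s ^+ 2) * expR (a * s) by rewrite /num /bump add0r mul1r.
pose k := num s0 / den s0.
have den0 s : 0 < den s by exact: pp.
have k0 : 0 < k.
  have /smax : 0 \in `[- r, r] by rewrite in_itv /=; apply/andP; split; lra.
  apply: lt_le_trans; rewrite divr_gt0// numE mulr0 expR0 mulr1 expr0n subr0.
  by rewrite exprn_gt0.
have nk : num s0 = k * den s0 by rewrite /k divfK ?gt_eqF.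
have touch s : num s <= k * den s.
  have [sr|sr] := boolP (- r <= s <= r).
    by rewrite -ler_pdivrMr//; apply: smax; rewrite in_itv.
  have : num s <= 0.
    rewrite numE pmulr_lle0 ?expR_gt0// subr_le0.
    have : 0 <= (s - r) * (s + r).
      by move: sr; rewrite negb_and -!ltNge => /orP[h|h]; nra.
    by rewrite -subr_sqr; lra.
  by move/le_trans; apply; rewrite mulr_ge0// ltW.
pose u := expR (a * s0); have u0 : 0 < u by exact: expR_gt0.
have [b [bE b_gt0]] : exists b : R, b = r ^+ 2 - s0 ^+ 2 /\ 0 < b.
  exists (r ^+ 2 - s0 ^+ 2); split=> //.
  by have : 0 < num s0; [rewrite nk mulr_gt0|rewrite numE pmulr_lgt0 ?expR_gt0].
have sgt : - r < s0.
  rewrite lt_neqAle s01 andbT; apply/eqP => h.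
  by rewrite bE -h sqrrN subrr ltxx in b_gt0.
have kden : k * den s0 = u * b by rewrite -nk numE -bE mulrC.
(* Compare slopes at s0, where num - k den is maximal. *)
have slope : k * wave_rhs D tau g c phi (y0 + s0) <= c * (u * (a * b - 2 * s0)).
  have dd : is_derive s0 1 (num - (k *: den))
     (1 * (- 2 * (0 + 1 * s0)) * expR (a * s0) + bump (0 + 1 * s0) * (a * expR (a * s0))
      - k *: (wave_rhs D tau g c phi (y0 + s0) / c)).
    exact: is_deriveB.
  have := derive_ge0_at_left_max dd sgt.
  have -> : 1 * (- 2 * (0 + 1 * s0)) * expR (a * s0) + bump (0 + 1 * s0) * (a * expR (a * s0))
      - k *: (wave_rhs D tau g c phi (y0 + s0) / c) = u * (a * b - 2 * s0) - k * wave_rhs D tau g c phi (y0 + s0) / c.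
    by rewrite /u /bump bE /GRing.scale /=; ring.
  move=> h; have {h} : k * wave_rhs D tau g c phi (y0 + s0) / c <= u * (a * b - 2 * s0).
    rewrite -subr_ge0; apply: h => s /andP[_ ss0].
    have := touch s; rewrite !fctE /GRing.scale /= nk; lra.
  by rewrite ler_pdivrMr// [leRHS]mulrC.
have sX : y0 + s0 <= X by rewrite /y0; lra.
have nbr (t q : R) : q = expR (a * t) -> u * q * (r ^+ 2 - (s0 + t) ^+ 2) <= k * phi (y0 + s0 + t).
  move=> ->; have := touch (s0 + t); rewrite numE mulrDr expRD /den addrA.
  by rewrite mulrC.
have nbp : u * p * (b - 2 * s0 - 1) <= k * phi (y0 + s0 + 1).
  have := nbr 1 p; rewrite mulr1 => /(_ pE).
  by rewrite (_ : r ^+ 2 - _ = b - 2 * s0 - 1)// bE; ring.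
have nbm : u * m * (b + 2 * s0 - 1) <= k * phi (y0 + s0 - 1).
  have := nbr (-1) m; rewrite mulrN1 => /(_ mE).
  by rewrite (_ : r ^+ 2 - _ = b + 2 * s0 - 1)// bE; ring.
have php : 0 < k * phi (y0 + s0 + 1) by rewrite mulr_gt0.
have phm : 0 < k * phi (y0 + s0 - 1) by rewrite mulr_gt0.
have low : D * (k * phi (y0 + s0 + 1) + k * phi (y0 + s0 - 1)) - 2 * D * (u * b)
    + u * b * (g 0 0 - sg / 2) <= c * (u * (a * b - 2 * s0)).
  apply: le_trans slope; rewrite /wave_rhs /local_rhs -/(den s0).
  have h := rate _ sX.
  have : u * b * (g 0 0 - sg / 2) <= u * b * g (den s0) (phi (y0 + s0 - c * tau)).
    by rewrite ler_pM2l// mulr_gt0.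
  rewrite -kden; lra.
have [bb|bb] := lerP b0 b.
  have h1 : D * (u * p * (b - 2 * s0 - 1) + u * m * (b + 2 * s0 - 1)) <=
      D * (k * phi (y0 + s0 + 1) + k * phi (y0 + s0 - 1)) by rewrite ler_pM2l//; lra.
  have h2 : D * (u * p * (b - 2 * s0 - 1) + u * m * (b + 2 * s0 - 1)) =
     u * (D * (p + m) * (b - 1) - 2 * s0 * c) by rewrite -aE; ring.
  have h3 : u * (D * (p + m) * (b - 1) - 2 * s0 * c - 2 * D * b + b * (g 0 0 - sg / 2)) <=
     u * (c * (a * b - 2 * s0)) by lra.
  rewrite ler_pM2l// in h3.
  have h4 : b0 * (sg / 2) <= b * (sg / 2) by rewrite ler_pM2r//; lra.
  have h5 : b * sg = b * (D * (p + m - 2) + g 0 0 - c * a) by rewrite sgE.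
  lra.
have sq : rho ^+ 2 < s0 ^+ 2 by lra.
have bW : b * (c * a + 2 * D - (g 0 0 - sg / 2)) <= b0 * W.
  have g0 : 0 < g 0 0.
    by rewrite (lt_le_trans (rate_01 gP))// (rate_nincr gP)// ler01.
  have h1 : b * (c * a + 2 * D - (g 0 0 - sg / 2)) <= b * W by rewrite ler_pM2l// /W; lra.
  have h2 : b * W <= b0 * W by rewrite ler_pM2r//; lra.
  lra.
have [sp|sn] := lerP 0 s0.
  have rs : rho < s0 by rewrite -(ltr_pXn2r (ltn0Sn 1)) ?nnegrE//; lra.
  have h1 : D * (u * m * (b + 2 * s0 - 1)) <=
      D * (k * phi (y0 + s0 + 1) + k * phi (y0 + s0 - 1)) by rewrite ler_pM2l//; lra.
  have h2 : u * (D * m * (b + 2 * s0 - 1) - 2 * D * b + b * (g 0 0 - sg / 2)) <=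
     u * (c * (a * b - 2 * s0)) by lra.
  rewrite ler_pM2l// in h2.
  have h3 : 0 <= D * m * (b + 2 * s0) by rewrite mulr_ge0 ?mulr_ge0//; lra.
  have h4 : 2 * c * rho <= 2 * c * s0 by rewrite ler_pM2l ?mulr_gt0//; lra.
  lra.
have rs : rho < - s0 by rewrite -(ltr_pXn2r (ltn0Sn 1)) ?nnegrE ?sqrrN//; lra.
have h1 : D * (u * p * (b - 2 * s0 - 1)) <=
    D * (k * phi (y0 + s0 + 1) + k * phi (y0 + s0 - 1)) by rewrite ler_pM2l//; lra.
have h2 : u * (D * p * (b - 2 * s0 - 1) - 2 * D * b + b * (g 0 0 - sg / 2)) <=
   u * (c * (a * b - 2 * s0)) by lra.
rewrite ler_pM2l// in h2.
have h3 : 0 <= D * p * b by rewrite !mulr_ge0// ltW.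
have h4 : 2 * D * m * rho <= 2 * D * m * (- s0) by rewrite ler_pM2l ?mulr_gt0//; lra.
have h5 : c * s0 = D * (p - m) * s0 by rewrite aE.
lra.
Qed.
End Nonexistence.

(** * Convergence to E *)
Section Asymptotics.
Variables (R : realType) (D tau : R) (g : R -> R -> R) (K G : R).
Implicit Types (phi : R -> R) (c x y e : R).

Lemma common_small (a b d : R) : 0 < a -> 0 < b -> 0 < d ->
  exists e, [/\ 0 < e, e <= a, e <= b & e <= d].
Proof.
move=> a0 b0 d0; exists (Num.min a (Num.min b d)).
by rewrite !lt_min !ge_min !lexx !orbT a0 b0 d0.
Qed.

(** If g(uh,ul) < 0, then wherever phi is within e of uh the diffusion term is at most
    4 D e and the growth term is at most ul g(uh,ul) / 4, so the slope is negative
    and phi would eventually stay below uh - e ([eventually_le]).  The argument at ul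
    is symmetric.  Moreover uh < 1, since g(1,ul) < g(1,0) = 0. *)
Theorem profile_cvg (E c : R) phi : 0 < D -> regular_rate g K G -> 0 <= tau -> 0 < c ->
  (forall v : R, 0 < v -> v <= 1 -> g 1 v < 0) -> H4 g E ->
  profile D tau g c phi ->
  (exists delta X : R, 0 < delta /\ forall x, X <= x -> delta <= phi x) ->
  phi x @[x --> +oo] --> E.
Proof.
move=> D0 gP t0 c0 g1 h4 [p01 dphi] [dl [X0 [dl0 hX0]]].
have K0 := rate_K gP.
pose lowS : set R := [set a | exists X, forall x, X <= x -> a <= phi x].
pose upS : set R := [set a | exists X, forall x, X <= x -> phi x <= a].
have lowup a b : lowS a -> upS b -> a <= b.
  move=> [X hX] [Y hY]; apply: (le_trans (hX (Num.max X Y) _)).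
    by rewrite le_max lexx.
  by apply: hY; rewrite le_max lexx orbT.
have lowdl : lowS dl by exists X0.
have up1 : upS 1 by exists 0 => x _; case/andP: (p01 x).
have supL : has_sup lowS by split; [exists dl|exists 1 => a ha; exact: lowup up1].
have infU : has_inf upS by split; [exists 1|exists dl => b hb; exact: lowup hb].
have [ul ulE] : {u : R | u = sup lowS} by exists (sup lowS).
have [uh uhE] : {u : R | u = inf upS} by exists (inf upS).
have ulmax a : lowS a -> a <= ul by rewrite ulE; exact: (ub_le_sup supL.2).
have uhmin a : upS a -> uh <= a by rewrite uhE; exact: (ge_inf infU.2).
have ul0 : 0 < ul by rewrite (lt_le_trans dl0)// ulmax.
have uh1 : uh <= 1 by exact: uhmin.
have uluh : ul <= uh.
  rewrite uhE; apply: lb_le_inf; first exact: infU.1.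
  by move=> b hb; rewrite ulE; apply: sup_le_ub; [exact: supL.1|move=> a ha; exact: lowup hb].
have ev e : 0 < e -> exists X, forall x, X <= x -> ul - e <= phi x <= uh + e.
  move=> e0; have [a [X hX] ha] := sup_adherent e0 supL.
  have [b [Y hY] hb] := inf_adherent e0 infU.
  rewrite -ulE in ha; rewrite -uhE in hb.
  exists (Num.max X Y) => x; rewrite ge_max => /andP[/hX h1 /hY h2].
  by apply/andP; split; lra.
have delayed e : 0 < e -> exists X, forall x, X <= x ->
    [/\ ul - e <= phi x <= uh + e, ul - e <= phi (x + 1) <= uh + e,
        ul - e <= phi (x - 1) <= uh + e & ul - e <= phi (x - c * tau) <= uh + e].
  move=> /ev[X hX]; exists (X + 1 + c * tau) => x Xx.
  have ct : 0 <= c * tau by rewrite mulr_ge0// ltW.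
  by split; apply: hX; lra.
have hul : 0 <= ul <= 1 by apply/andP; split; lra.
have huh : 0 <= uh <= 1 by apply/andP; split; lra.
have small rho : 0 < rho -> exists e, [/\ 0 < e, e <= ul / 2, 2 * K * e <= rho / 2 &
    4 * D * e <= ul * rho / 8].
  move=> rho0; have [|||e [e0 e1 e2 e3]] := @common_small (ul / 2) (rho / 2 / (2 * K))
      (ul * rho / 8 / (4 * D)).
  - by rewrite divr_gt0.
  - by rewrite !divr_gt0 ?mulr_gt0.
  - by rewrite !divr_gt0 ?mulr_gt0.
  exists e; split=> //.
    by rewrite mulrC -ler_pdivlMr ?mulr_gt0.
  by rewrite mulrC -ler_pdivlMr ?mulr_gt0.
have gh : 0 <= g uh ul.
  rewrite leNgt; apply/negP => gneg.
  have rho0 : 0 < - g uh ul by rewrite oppr_gt0.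
  have [e [e0 e1 e2 e3]] := small _ rho0.
  have [X hX] := delayed e e0.
  pose kap := ul * - g uh ul / 8.
  have kap0 : 0 < kap by rewrite divr_gt0 ?mulr_gt0.
  have [|x Xx hpx|Y hY] := @eventually_le R phi _ (uh - e) X (kap / c) dphi.
  - by rewrite divr_gt0.
  - have [/andP[a1 a2] /andP[b1 b2] /andP[d1 d2] /andP[f1 f2]] := hX x Xx.
    have r1 : g (phi x) (phi (x - c * tau)) - 2 * K * e <= g uh ul.
      by apply: (rate_ge_approx gP) => //; lra.
    rewrite -mulNr ler_pM2r ?invr_gt0// /wave_rhs /local_rhs.
    have r2 : D * (phi (x + 1) + phi (x - 1) - 2 * phi x) <= D * (4 * e).
      by rewrite ler_pM2l//; lra.
    have r3 : phi x * g (phi x) (phi (x - c * tau)) <= phi x * (g uh ul / 2).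
      by rewrite ler_pM2l//; lra.
    have r4 : phi x * (g uh ul / 2) <= ul / 2 * (g uh ul / 2).
      by rewrite ler_nM2r//; lra.
    rewrite /kap; lra.
  have : upS (uh - e) by exists Y.
  by move/uhmin; lra.
have gl : g ul uh <= 0.
  rewrite leNgt; apply/negP => rho0.
  have [e [e0 e1 e2 e3]] := small _ rho0.
  have [X hX] := delayed e e0.
  pose kap := ul * g ul uh / 8.
  have kap0 : 0 < kap by rewrite divr_gt0 ?mulr_gt0.
  have [|x Xx hpx|Y hY] := @eventually_ge R phi _ (ul + e) X (kap / c) dphi.
  - by rewrite divr_gt0.
  - have [/andP[a1 a2] /andP[b1 b2] /andP[d1 d2] /andP[f1 f2]] := hX x Xx.
    have r1 : g ul uh - 2 * K * e <= g (phi x) (phi (x - c * tau)).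
      by apply: (rate_ge_approx gP) => //; lra.
    rewrite ler_pM2r ?invr_gt0// /wave_rhs /local_rhs.
    have r2 : D * (- (4 * e)) <= D * (phi (x + 1) + phi (x - 1) - 2 * phi x).
      by rewrite ler_pM2l//; lra.
    have r3 : phi x * (g ul uh / 2) <= phi x * g (phi x) (phi (x - c * tau)).
      by rewrite ler_pM2l//; lra.
    have r4 : ul / 2 * (g ul uh / 2) <= phi x * (g ul uh / 2).
      by rewrite ler_pM2r//; lra.
    rewrite /kap; lra.
  have : lowS (ul + e) by exists Y.
  by move/ulmax; lra.
have uh_lt1 : uh < 1.
  rewrite lt_neqAle uh1 andbT; apply/eqP => uhe; rewrite uhe in gh uluh.
  by have := g1 ul ul0 uluh; lra.
have [ulE' uhE'] := h4 ul uh ul0 uluh uh_lt1 gl gh.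
apply/cvgrPdist_le => e e0; have [X hX] := ev e e0.
near=> x; have /hX : X <= x by near: x; apply: nbhs_pinfty_ge; exact: num_real.
by rewrite ulE' uhE' distrC ler_norml => /andP[? ?]; apply/andP; split; lra.
Unshelve. all: by end_near. Qed.
End Asymptotics.

(** * The minimal speed *)
Section Speed.
Variables (R : realType) (D : R) (g : R -> R -> R).
Hypothesis D0 : 0 < D.
Hypothesis g00 : 0 < g 0 0.
Local Notation speed l := ((D * (expR l + expR (- l) - 2) + g 0 0) / l).

(** The right-hand side is the square of e^{l/2} - e^{-l/2}, which is at least l/2. *)
Lemma cosh_ge (l : R) : 0 < l -> l ^+ 2 / 4 <= expR l + expR (- l) - 2.
Proof.
move=> l0; pose a := expR (l / 2); pose b := expR (- (l / 2)).
have ab : a * b = 1 by rewrite /a /b -expRD subrr expR0.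
have a2 : expR l = a ^+ 2 by rewrite /a -expRM_natr; congr expR; field.
have b2 : expR (- l) = b ^+ 2 by rewrite /b -expRM_natr; congr expR; field.
have h1 : 1 + l / 2 <= a by exact: expR_ge1Dx.
have h2 : b <= 1 by rewrite /b -[leRHS]expR0 ler_expR oppr_le0 divr_ge0// ltW.
rewrite a2 b2 (_ : _ - 2 = (a - b) ^+ 2); last by rewrite sqrrB ab; ring.
rewrite (_ : l ^+ 2 / 4 = (l / 2) ^+ 2); last by field.
by clearbody a b; rewrite lerXn2r ?nnegrE//; lra.
Qed.

Lemma speed_ge (l : R) : 0 < l -> Num.min (g 0 0) (D / 4) <= speed l.
Proof.
have D0' := D0; have g0' := g00.
move=> l0; rewrite ler_pdivlMr//; have h := cosh_ge l0.
have h1 : D * (l ^+ 2 / 4) <= D * (expR l + expR (- l) - 2) by rewrite ler_pM2l.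
have [l1|l1] := lerP l 1.
  rewrite (@le_trans _ _ (g 0 0 * l))//; first by rewrite ler_pM2r// ge_min lexx.
  have : g 0 0 * l <= g 0 0 by rewrite ler_piMr// ltW.
  have : 0 <= D * (l ^+ 2 / 4) by rewrite mulr_ge0 ?divr_ge0 ?sqr_ge0// ltW.
  lra.
rewrite (@le_trans _ _ (D / 4 * l))//; first by rewrite ler_pM2r// ge_min lexx orbT.
have : D / 4 * l <= D / 4 * l ^+ 2.
  by rewrite ler_pM2l ?divr_gt0// expr2 ler_peMr// ltW.
lra.
Qed.

Let S : set R := [set speed l | l in [set l : R | 0 < l]].

Let S_lb : has_lbound S.
Proof. by exists (Num.min (g 0 0) (D / 4)) => _ [l l0 <-]; exact: speed_ge. Qed.

Let S_ne : S !=set0.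
Proof. by exists (speed 1); exists 1 => //=. Qed.

Lemma cstar_gt0 : 0 < cstar D g.
Proof.
apply: (@lt_le_trans _ _ (Num.min (g 0 0) (D / 4))).
  by rewrite lt_min g00 divr_gt0.
by apply: lb_le_inf => // _ [l l0 <-]; exact: speed_ge.
Qed.

Lemma subcritical_dispersion (c : R) : c < cstar D g ->
  forall l : R, 0 < l -> 0 < dispersion D (g 0 0) l (c * l).
Proof.
move=> cc l l0; have : c < speed l.
  by apply: (lt_le_trans cc); apply: ge_inf => //; exists l.
by rewrite ltr_pdivlMr// /dispersion; lra.
Qed.

Lemma supercritical_dispersion (c : R) : cstar D g < c ->
  exists2 l : R, 0 < l & dispersion D (g 0 0) l (c * l) < 0.
Proof.
move=> cc; have [_ [l l0 <-] h] := inf_lt S_ne cc.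
by exists l => //; move: h; rewrite ltr_pdivrMr// /dispersion; lra.
Qed.
End Speed.

(** * Profiles and travelling waves *)
Section Translation.
Variables (R : realType) (D tau : R) (g : R -> R -> R) (K G : R).
Implicit Types (phi : R -> R) (c x y e : R).

(** Every x is of the form n + c t with n an integer and t > 0. *)
Lemma lattice_to_profile c phi : 0 < c ->
  lattice_solution D tau g (fun n t => phi (n%:~R + c * t)) ->
  forall x, is_derive x 1 phi (wave_rhs D tau g c phi x / c).
Proof.
move=> c0 sol x; have [n nE] : {n : int | n = Num.floor x - 1} by exists (Num.floor x - 1).
pose t := (x - n%:~R) / c.
have xn : 0 < x - n%:~R.
  by have := floor_le x; rewrite nE intrB; lra.
have t0 : 0 < t by rewrite divr_gt0.
have xE : n%:~R + c * t = x by rewrite /t mulrCA mulfV ?gt_eqF// mulr1; ring.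
have := sol n t t0; rewrite /= !intrD.
have -> : n%:~R + 1%:~R + c * t = x + 1 by rewrite -xE; ring.
have -> : n%:~R + (-1)%:~R + c * t = x - 1 by rewrite -xE; ring.
have -> : n%:~R + c * (t - tau) = x - c * tau by rewrite -xE; ring.
rewrite xE => dt.
have dl : is_derive x 1 (fun y : R => (y - n%:~R) / c) c^-1.
  by apply: is_derive_eq; rewrite /GRing.scale /=; ring.
have dt' : is_derive ((x - n%:~R) / c) 1 (fun t : R => phi (n%:~R + c * t)) (wave_rhs D tau g c phi x).
  by rewrite -/t /wave_rhs /local_rhs (_ : _ + _ - 2 * _ = phi (x + 1) - 2 * phi x + phi (x - 1)) //; ring.
have d := @is_derive1_comp R (fun t : R => phi (n%:~R + c * t))
  (fun y : R => (y - n%:~R) / c) x _ _ dt' dl.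
have : ((fun t : R => phi (n%:~R + c * t)) \o (fun y : R => (y - n%:~R) / c)) = phi.
  by apply/funext => y /=; rewrite mulrCA mulfV ?gt_eqF// mulr1 subrKC.
by move=> e; rewrite e in d.
Qed.

Lemma profile_to_lattice c phi : 0 < c -> profile D tau g c phi ->
  lattice_solution D tau g (fun n t => phi (n%:~R + c * t)).
Proof.
move=> c0 [_ dphi] n t _ /=.
have d1 : is_derive t 1 (fun s : R => n%:~R + c * s) c.
  by apply: is_derive_eq; rewrite /GRing.scale /=; ring.
have d2 : is_derive t 1 (phi \o (fun s : R => n%:~R + c * s))
    (wave_rhs D tau g c phi (n%:~R + c * t) / c * c) by exact: is_derive1_comp.
rewrite divfK ?gt_eqF// in d2; move: d2; rewrite /wave_rhs /local_rhs !intrD.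
have -> : n%:~R + 1%:~R + c * t = n%:~R + c * t + 1 by ring.
have -> : n%:~R + (-1)%:~R + c * t = n%:~R + c * t - 1 by ring.
have -> : n%:~R + c * (t - tau) = n%:~R + c * t - c * tau by ring.
by rewrite [_ + phi _ - 2 * _]addrAC.
Qed.

Lemma lipschitz_unif_continuous (f : R -> R) (L : R) :
  (forall x y, `|f x - f y| <= L * `|x - y|) -> unif_continuous f.
Proof.
move=> fL; apply/unif_continuousP => e e0.
have L0 : 0 < `|L| + 1 by rewrite ltr_wpDl.
exists (e / (`|L| + 1)); first by rewrite /= divr_gt0.
move=> [x y] /=; rewrite /ball /= ltr_pdivlMr// => h.
apply: le_lt_trans (fL x y) _; apply: le_lt_trans h.
by rewrite mulrC ler_wpM2l// (le_trans (ler_norm L))// lerDl.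
Qed.

Lemma bounded_by (f : R -> R) (M : R) : (forall x, `|f x| <= M) -> bounded_fun f.
Proof.
move=> h; exists M; split; first exact: num_real.
by move=> M' MM x _; apply: (le_trans (h x)); exact: ltW.
Qed.

Lemma profile_C1 c phi : 0 < D -> regular_rate g K G -> 0 < c -> profile D tau g c phi ->
  C1_buc phi.
Proof.
move=> D0 gP c0 pP; have [p01 dphi] := pP.
have dE : derive1 phi = (fun x => wave_rhs D tau g c phi x / c).
  by apply/funext => x; rewrite derive1E; exact: derive_val.
split.
- by move=> x; have [] := dphi x.
- exact: (lipschitz_unif_continuous (profile_lip D0 gP c0 pP)).
- by apply: (@bounded_by _ 1) => x; rewrite ger0_norm; case/andP: (p01 x).
- rewrite dE; apply: (@lipschitz_unif_continuous _ ((4 * D + G + 2 * K) * ((2 * D + G) / c) / c)).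
  move=> x y; rewrite -mulrBl normrM normfV (gtr0_norm c0).
  rewrite [leRHS]mulrAC ler_pM2r ?invr_gt0// -mulrA; exact: wave_rhs_lip.
- rewrite dE; apply: (@bounded_by _ ((2 * D + G) / c)) => x.
  rewrite normrM normfV (gtr0_norm c0) ler_pM2r ?invr_gt0//.
  exact: (local_rhs_le (K := K)).
Qed.

Lemma liminf_gt0 phi : (0 < liminf_pinfty phi)%E <->
  exists delta X : R, 0 < delta /\ forall x, X <= x -> delta <= phi x.
Proof.
rewrite /liminf_pinfty limf_einfE; split; last first.
  move=> [dl [X [dl0 h]]]; apply: (@lt_le_trans _ _ dl%:E); first by rewrite lte_fin.
  apply: le_ereal_sup_tmp; exists (ereal_inf ((EFin \o phi) @` [set x | X <= x])).
    exists [set x | X <= x] => //; apply: nbhs_pinfty_ge; exact: num_real.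
  by apply: le_ereal_inf_tmp => _ [x Xx <-]; rewrite lee_fin; exact: h.
move=> /ereal_sup_gt[_ [V [M [_ MV]] <-]] h.
have [r [r0 rh]] : exists r : R, 0 < r /\ (r%:E <= ereal_inf ((EFin \o phi) @` V))%E.
  move: h; case: (ereal_inf _) => [r| |] //; rewrite ?lte_fin => r0.
    by exists r.
  by exists 1; rewrite leey.
exists r, (M + 1); split=> // x xM.
rewrite -lee_fin; apply: (le_trans rh); apply: ereal_inf_lbound; exists x => //.
by apply: MV; lra.
Qed.

Lemma limsup_le1 phi : (forall x, phi x <= 1) -> (limsup_pinfty phi <= 1)%E.
Proof.
move=> h; rewrite /limsup_pinfty limf_esupE; apply: ge_ereal_inf.
exists (ereal_sup ((EFin \o phi) @` setT)).
  by exists setT => //; exact: filterT.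
by apply: ge_ereal_sup => _ [x _ <-]; rewrite lee_fin.
Qed.

Lemma liminf_le_limsup phi : (liminf_pinfty phi <= limsup_pinfty phi)%E.
Proof.
rewrite /liminf_pinfty /limsup_pinfty limf_einfE limf_esupE.
apply: ge_ereal_sup => _ [V FV <-]; apply: le_ereal_inf_tmp => _ [W FW <-].
have [x [Vx Wx]] := filter_ex (filterI FV FW).
apply: (@le_trans _ _ (phi x)%:E).
  by apply: ereal_inf_lbound; exists x.
by apply: ereal_sup_ubound; exists x.
Qed.

Lemma cvg_ninfty0 phi : (forall x, 0 < phi x) ->
  phi x @[x --> -oo] --> (0 : R) <->
  forall e, 0 < e -> exists X : R, forall x, x <= X -> phi x <= e.
Proof.
move=> pp; split.
  move=> /cvgrPdist_le h e /h[M [_ hM]]; exists (M - 1) => x xM.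
  have := hM x; rewrite sub0r normrN gtr0_norm//; apply; lra.
move=> h; apply/cvgrPdist_le => e /h[X hX].
near=> x; rewrite sub0r normrN gtr0_norm//; apply: hX.
by near: x; apply: nbhs_ninfty_le; exact: num_real.
Unshelve. all: by end_near. Qed.
End Translation.

Theorem theorem3p1 (R : realType) (D tau : R) (g : R -> R -> R) (E : R)
    (hD : 0 < D) (htau : 0 <= tau)
    (h1 : H1 g) (h2 : H2 g) (h3 : H3 g E) (c : R) :
  [/\ cstar D g <= c ->
        exists phi : R -> R,
          [/\ positive_traveling_wave D tau g c phi,
              condB phi
            & H4 g E -> connects_0_E E phi],
      0 < c < cstar D g ->
        ~ exists phi : R -> R,
            positive_traveling_wave D tau g c phi /\ condB phi
    & H4 g E -> cstar D g <= c ->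
        forall phi : R -> R,
          positive_traveling_wave D tau g c phi -> condB phi ->
          (forall xi : R, phi xi <= 1) -> connects_0_E E phi].
Proof.
have [K [G gP]] := regular_rate_exists h1 h2 h3.
have g00 : 0 < g 0 0.
  by rewrite (lt_le_trans (rate_01 gP))// (rate_nincr gP)// ler01.
have g1 v : 0 < v -> v <= 1 -> g 1 v < 0.
  move=> v0 v1; have [_ _ dec _] := h2.
  by rewrite -(rate_10 gP); apply: dec; rewrite ?ler01 ?lexx.
have cpos : cstar D g <= c -> 0 < c by exact: lt_le_trans (cstar_gt0 hD g00).
have toE phi : 0 < c -> H4 g E -> positive_traveling_wave D tau g c phi ->
    condB phi -> (forall xi, phi xi <= 1) -> connects_0_E E phi.
  move=> c0 h4 [[_ _ sol] pp] [l0 li _ _] p1; split=> //.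
  have dphi := lattice_to_profile c0 sol.
  apply: (profile_cvg hD gP htau c0 g1 h4).
    by split=> [x|]; [rewrite ltW ?pp ?p1|exact: dphi].
  exact/liminf_gt0.
split.
- move=> cc; have c0 := cpos cc.
  have [|phi [pP pp p0 pinf]] := profile_exists hD gP htau c0.
    by move=> c' cc'; apply: supercritical_dispersion => //; exact: le_lt_trans cc'.
  have p1 x : phi x <= 1 by have [/(_ x)/andP[]] := pP.
  have wave : positive_traveling_wave D tau g c phi.
    split=> //; split=> //; first exact: (profile_C1 hD gP c0 pP).
    exact: profile_to_lattice.
  have B : condB phi.
    split; [exact/cvg_ninfty0|exact/liminf_gt0|exact: liminf_le_limsup|exact: limsup_le1].
  by exists phi; split=> // h4; exact: toE.
- move=> /andP[c0 cc] [phi [[[_ _ sol] pp] [l0 _ _ _]]].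
  apply: (no_subcritical_profile hD gP htau c0 _ (lattice_to_profile c0 sol) pp).
    exact: subcritical_dispersion.
  exact/cvg_ninfty0.
- by move=> h4 cc phi wave B p1; apply: toE => //; exact: cpos.
Qed.
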